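(* For any integer $j\ge1$, the function $\theta\mapsto\lambda_j(\theta)$ defined by $$\lambda_j(\theta)=\inf_{\substack{\psi_1,\dots,\psi_j\text{ linearly independent in }H^1(\Omega^+_\theta)\\ \psi_1,\dots,\psi_j=0\text{ on }\partial_{\mathsf{Dir}}\Omega^+_\theta}}\ \ \sup_{\psi\in[\psi_1,\dots,\psi_j]\setminus\{0\}}\frac{\|\nabla\psi\|^2_{L^2(\Omega^+_\theta)}}{\|\psi\|^2_{L^2(\Omega^+_\theta)}}$$ is non-decreasing from $(0,\frac{\pi}{2})$ into $\mathbb{R}_+$.
   Context: For $\theta\in(0,\frac{\pi}{2})$ the broken guide is $$\Omega_\theta=\Big\{(x_1,x_2)\in\mathbb{R}^2:\ x_1\tan\theta<|x_2|<\Big(x_1+\frac{\pi}{\sin\theta}\Big)\tan\theta\Big\},$$ the half-guide is $\Omega^+_\theta=\{(x_1,x_2)\in\Omega_\theta:\ x_2>0\}$, and $\partial_{\mathsf{Dir}}\Omega^+_\theta=\partial\Omega_\theta\cap\partial\Omega^+_\theta$. Boundary conditions are in the sense of traces, and $[\psi_1,\dots,\psi_j]$ denotes the linear span of $\psi_1,\dots,\psi_j$. *)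

(* Defs.v *)
From HB Require Import structures.
From mathcomp Require Import all_boot all_order all_algebra.
From mathcomp Require Import all_classical all_reals all_analysis.
Set Implicit Arguments.
Unset Strict Implicit.
Unset Printing Implicit Defensive.
Import Order.TTheory GRing.Theory Num.Theory.
Import numFieldNormedType.Exports.
Local Open Scope classical_set_scope.
Local Open Scope ring_scope.

Definition lebesgue2 (R : realType)
    : {measure set (measurableTypeR R * measurableTypeR R) -> \bar R} :=
  (@lebesgue_measure R \x @lebesgue_measure R)%E.

Definition e1 (R : realType) : R * R := (1, 0).
Definition e2 (R : realType) : R * R := (0, 1).

Fixpoint Ck (R : realType) (k : nat) (f : R * R -> R) : Prop :=
  if k is k'.+1 then
    [/\ continuous f,
        (forall x, derivable f x (e1 R) /\ derivable f x (e2 R)),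
        Ck k' ('D_(e1 R) f) & Ck k' ('D_(e2 R) f)]
  else continuous f.

Definition smooth (R : realType) (f : R * R -> R) : Prop := forall k, Ck k f.

Definition support (R : realType) (f : R * R -> R) : set (R * R) :=
  closure [set x | f x != 0].

(* C_c^oo(A), as functions on the plane *)
Definition test_function (R : realType) (A : set (R * R)) (f : R * R -> R) :
    Prop :=
  [/\ smooth f, compact (support f) & support f `<=` A].

(* A function on A is represented by a function on the plane, of which only the
   values on A matter; elements of L^2(A) and H^1(A) are such representatives,
   identified when they agree almost everywhere on A. *)
Definition sqnorm (R : realType) (A : set (R * R)) (u : R * R -> R) : \bar R :=
  (\int[@lebesgue2 R]_(x in A) (u x ^+ 2)%:E)%E.

Definition in_L2 (R : realType) (A : set (R * R)) (u : R * R -> R) : Prop :=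
  measurable_fun (A : set (measurableTypeR R * measurableTypeR R)) u /\
  (sqnorm A u < +oo)%E.

Definition is_weak_partial (R : realType) (A : set (R * R)) (v : R * R)
    (u g : R * R -> R) : Prop :=
  in_L2 A g /\
  forall phi, test_function A phi ->
    \int[@lebesgue2 R]_(x in A) (u x * 'D_v phi x) =
    - \int[@lebesgue2 R]_(x in A) (g x * phi x).

(* A representative of the weak derivative of u in the direction v, unique up to
   a null set when A is open; the value 0 when there is none is never used for u
   in H^1(A). *)
Definition weak_partial (R : realType) (A : set (R * R)) (v : R * R)
    (u : R * R -> R) : R * R -> R :=
  xget (cst 0) [set g | is_weak_partial A v u g].

Definition in_H1 (R : realType) (A : set (R * R)) (u : R * R -> R) : Prop :=
  [/\ in_L2 A u,
      (exists g, is_weak_partial A (e1 R) u g) &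
      (exists g, is_weak_partial A (e2 R) u g)].

Definition grad_sqnorm (R : realType) (A : set (R * R)) (u : R * R -> R) :
    \bar R :=
  (sqnorm A (weak_partial A (e1 R) u) + sqnorm A (weak_partial A (e2 R) u))%E.

Definition H1_sqnorm (R : realType) (A : set (R * R)) (u : R * R -> R) :
    \bar R :=
  (sqnorm A u + grad_sqnorm A u)%E.

Definition boundary (R : realType) (A : set (R * R)) : set (R * R) :=
  closure A `\` A°.

Definition guide (R : realType) (theta : R) : set (R * R) :=
  [set x | x.1 * tan theta < `|x.2| /\
           `|x.2| < (x.1 + pi / sin theta) * tan theta].

Definition half_guide (R : realType) (theta : R) : set (R * R) :=
  [set x | guide theta x /\ 0 < x.2].

Definition dir_boundary (R : realType) (theta : R) : set (R * R) :=
  boundary (guide theta) `&` boundary (half_guide theta).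

(* Unit speed parametrization of the line of slope tan theta through (a, 0). *)
Definition line (R : realType) (theta a : R) (t : R) : R * R :=
  (a + t * cos theta, t * sin theta).

(* Squared norm of g in L^2 of the Dirichlet boundary, for arc length: that
   boundary is made of two half-lines, carried by the lines of slope tan theta
   through (0, 0) and (- pi / sin theta, 0). *)
Definition dir_sqnorm (R : realType) (theta : R) (g : R * R -> R) : \bar R :=
  (\int[@lebesgue_measure R]_(t in line theta 0 @^-1` dir_boundary theta)
      (g (line theta 0 t) ^+ 2)%:E +
   \int[@lebesgue_measure R]_(t in
      line theta (- (pi / sin theta)) @^-1` dir_boundary theta)
      (g (line theta (- (pi / sin theta)) t) ^+ 2)%:E)%E.

(* g is the trace of u on the Dirichlet boundary: the trace operator is the
   continuous extension, from H^1 of the half-guide to L^2 of the boundary, of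
   the restriction map on C_c^oo(R^2). *)
Definition is_dir_trace (R : realType) (theta : R) (u g : R * R -> R) : Prop :=
  exists phi : nat -> R * R -> R,
    [/\ (forall n, test_function setT (phi n)),
        (fun n => H1_sqnorm (half_guide theta) (phi n \- u)) @ \oo --> 0%E &
        (fun n => dir_sqnorm theta (phi n \- g)) @ \oo --> 0%E].

Definition in_H1_dir (R : realType) (theta : R) (u : R * R -> R) : Prop :=
  in_H1 (half_guide theta) u /\ is_dir_trace theta u (cst 0).

Definition lin_comb (R : realType) (j : nat) (c : 'I_j -> R)
    (psi : 'I_j -> R * R -> R) : R * R -> R :=
  fun x => \sum_(i < j) c i * psi i x.

Definition ae_zero (R : realType) (A : set (R * R)) (u : R * R -> R) : Prop :=
  {ae @lebesgue2 R, forall x, A x -> u x = 0}.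

Definition lin_indep (R : realType) (A : set (R * R)) (j : nat)
    (psi : 'I_j -> R * R -> R) : Prop :=
  forall c : 'I_j -> R, ae_zero A (lin_comb c psi) -> forall i, c i = 0.

(* Both norms are finite for u in H^1(A). *)
Definition rayleigh (R : realType) (A : set (R * R)) (u : R * R -> R) : R :=
  fine (grad_sqnorm A u) / fine (sqnorm A u).

Definition sup_rayleigh (R : realType) (A : set (R * R)) (j : nat)
    (psi : 'I_j -> R * R -> R) : \bar R :=
  ereal_sup [set (rayleigh A u)%:E | u in
    [set u | (exists c, u = lin_comb c psi) /\ ~ ae_zero A u]].

Definition lambda (R : realType) (j : nat) (theta : R) : \bar R :=
  ereal_inf [set sup_rayleigh (half_guide theta) psi | psi in
    [set psi : 'I_j -> R * R -> R |
      (forall i, in_H1_dir theta (psi i)) /\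
      lin_indep (half_guide theta) psi]].

(* Main.v *)
From HB Require Import structures.
From mathcomp Require Import all_boot all_order all_algebra.
From mathcomp Require Import all_classical all_reals all_analysis.
From mathcomp Require Import measurable_realfun ring lra.
Require Import Defs.
Set Implicit Arguments.
Unset Strict Implicit.
Unset Printing Implicit Defensive.
Import Order.TTheory GRing.Theory Num.Theory.
Import numFieldNormedType.Exports.
Local Open Scope classical_set_scope.
Local Open Scope ring_scope.

(** The trial functions for the larger angle are carried to the smaller one by
    a linear change of variables which contracts gradients.

    In coordinates along and across the guide, the half-guide is a half-strip
    of width [pi] cut by a line whose slope depends on [theta].  Stretching the
    longitudinal coordinate by [k = tan th1 / tan th2] maps the half-strip of
    [th1] onto that of [th2], and [k <= 1] when [th1 <= th2].  Read in the
    plane, this is a linear map [T] ([guide_map]); it preserves the horizontal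
    axis, which carries the cut, so it is triangular:
    [T (x1, x2) = (a x1 + b x2, c x2)].  It takes each Dirichlet half-line of
    [th1] onto the corresponding one of [th2], at constant speed [k].  For [psi]
    admissible for [th2], the function [psi o T] is admissible for [th1]; the
    squared norm of [psi] is multiplied by [(a c)^-1], and its gradient [w]
    becomes [T^t w], of squared length [|w|^2 - (1 - k^2) w_l^2 <= |w|^2], where
    [w_l] is the longitudinal component of [w] ([guide_map_contracting]).  Every
    Rayleigh quotient can only decrease ([rayleigh_transport]), and so can the
    min-max value ([lambda_le]).

    Four facts make this rigorous for weak derivatives and traces.  The change
    of variables for triangular maps comes from Fubini and the affine case on
    the line ([ge0_integral_shear]).  The weak chain rule
    ([is_weak_partial_shear]) is obtained by moving the test functions through
    [T], which keeps them smooth ([Ck_comp_shear]).  The gradient norm is that of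
    a chosen weak derivative, so it is known only once weak derivatives are
    shown to be unique almost everywhere; this is the du Bois-Reymond lemma
    ([du_bois_reymond]), proved with smooth bumps converging to the indicator of
    a box and a Dynkin class argument.  A zero trace is transported along the
    approximating sequence that defines it, the H^1 norms shrinking up to the
    Jacobian factor ([is_dir_trace_transport]).

    The min-max value is nonnegative because a trial space contains a nonzero
    function, and finite because [j] bumps with disjoint supports span a trial
    space on which both quadratic forms are diagonal
    ([sup_rayleigh_disjoint_lty]). *)

Local Notation plane R := (measurableTypeR R * measurableTypeR R)%type.

(** * Change of variables for triangular maps of the plane *)

Lemma measurable_affine (R : realType) (a b : R) :
  measurable_fun setT (fun x : R => a * x + b).
Proof.
apply: measurable_funD; last exact: measurable_cst.
by apply: measurable_funM; [exact: measurable_cst|exact: measurable_id].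
Qed.

(** The image of Lebesgue measure under the affine map, rescaled by [a], gives
    every half-open interval its length, so it is Lebesgue measure. *)
Lemma ge0_integral_affine (R : realType) (a b : R) (f : R -> \bar R) :
  0 < a -> measurable_fun setT f -> (forall x, (0 <= f x)%E) ->
  (\int[@lebesgue_measure R]_x f (a * x + b)%R =
   a^-1%:E * \int[@lebesgue_measure R]_x f x)%E.
Proof.
move=> a0 mf f0.
pose phi : measurableTypeR R -> measurableTypeR R := fun x => a * x + b.
have mphi : measurable_fun setT phi by exact: measurable_affine.
pose m0 : {measure set measurableTypeR R -> \bar R} :=
  mscale (NngNum (ltW a0)) (pushforward lebesgue_measure phi).
pose m := m0 mphi.
have eqm A : measurable A -> lebesgue_measure A = m A.
  apply: lebesgue_measure_unique => _ [[x y]] _ <-.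
  transitivity (a%:E * lebesgue_measure (phi @^-1` `]x, y]))%E; last by [].
  rewrite (_ : _ @^-1` _ = `](x - b) / a, (y - b) / a]%classic); last first.
    apply/seteqP; split => t /=; rewrite !in_itv/= ltr_pdivrMr// ler_pdivlMr//;
    by rewrite ltrBlDr lerBrDr mulrC.
  rewrite !lebesgue_measure_itv/= !lte_fin ltr_pM2r ?invr_gt0// ltrD2r.
  case: ifPn => _; last by rewrite mule0.
  by rewrite -!EFinB -EFinM; congr (_%:E); field; rewrite gt_eqF.
have -> : (\int[lebesgue_measure]_x f x = \int[m]_x f x)%E.
  by apply: eq_measure_integral => A mA _; exact: eqm.
rewrite /m /m0 ge0_integral_mscale// ge0_integral_pushforward//.
by rewrite muleA -EFinM mulVf ?gt_eqF// mul1e preimage_setT.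
Qed.

Section Shear.
Variables (R : realType).
Implicit Types (a b c : R).

Definition shear a b c (x : R * R) : R * R := (a * x.1 + b * x.2, c * x.2).

Definition shear_inv a b c : R * R -> R * R := shear a^-1 (- (b / (a * c))) c^-1.

Lemma shearK a b c : a != 0 -> c != 0 -> cancel (shear a b c) (shear_inv a b c).
Proof. by move=> a0 c0 [x y]; congr (_, _) => /=; field; rewrite ?a0 ?c0. Qed.

Lemma shear_invK a b c :
  a != 0 -> c != 0 -> cancel (shear_inv a b c) (shear a b c).
Proof. by move=> a0 c0 [x y]; congr (_, _) => /=; field; rewrite ?a0 ?c0. Qed.

Lemma measurable_shear a b c :
  measurable_fun setT (shear a b c :
    measurableTypeR R * measurableTypeR R -> measurableTypeR R * measurableTypeR R).
Proof.
apply: measurable_fun_pair => /=.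
  apply: measurable_funD; apply: measurable_funM;
    [exact: measurable_cst|exact: measurable_fst|exact: measurable_cst|exact: measurable_snd].
by apply: measurable_funM; [exact: measurable_cst|exact: measurable_snd].
Qed.

(** On each horizontal line the map is affine, and it permutes these lines by a
    dilation: Fubini reduces the claim to two affine changes of variable. *)
Lemma ge0_integral_shear a b c (f : R * R -> \bar R) : 0 < a -> 0 < c ->
  measurable_fun (setT : set (measurableTypeR R * measurableTypeR R)) f ->
  (forall x, (0 <= f x)%E) ->
  (\int[@lebesgue2 R]_x f (shear a b c x) =
   (a * c)^-1%:E * \int[@lebesgue2 R]_x f x)%E.
Proof.
move=> a0 c0 mf f0; rewrite /lebesgue2.
have ai0 : (0 <= a^-1%:E)%E by rewrite lee_fin invr_ge0 ltW.
rewrite !fubini_tonelli2//; last first.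
  exact: measurableT_comp mf (@measurable_shear _ _ _).
rewrite /fubini_G /=.
have mG := @measurable_fun_fubini_tonelli_G _ _ _ _ _ (@lebesgue_measure R) f mf f0.
under eq_integral => y _.
  rewrite (_ : integral _ _ _ =
      (a^-1%:E * \int[lebesgue_measure]_x f (x, (c * y + 0)%R))%E); last first.
    rewrite -(@ge0_integral_affine _ a (b * y) (fun x => f (x, c * y + 0)))//.
      by rewrite addr0.
    exact: measurableT_comp mf (pair2_measurable _).
  over.
rewrite ge0_integralZl//=.
- rewrite (@ge0_integral_affine _ c 0 (fun y => \int[lebesgue_measure]_x f (x, y)))%E//.
  + by rewrite muleA -EFinM -invfM.
  + by move=> y; apply: integral_ge0.
- exact: measurableT_comp mG (measurable_affine _ _).
- by move=> y _; apply: integral_ge0.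
Qed.

End Shear.

Section ShearIntegral.
Variables (R : realType) (a b c : R).
Hypotheses (a0 : 0 < a) (c0 : 0 < c).
Notation T := (shear a b c).

Lemma measurable_preimage_shear (A : set (plane R)) :
  measurable A -> measurable (T @^-1` A : set (plane R)).
Proof.
by move=> mA; rewrite -[X in measurable X]setTI; apply: (@measurable_shear R a b c).
Qed.

Lemma measurable_fun_shear d (Y : measurableType d) (A : set (plane R)) (f : plane R -> Y) :
  measurable A -> measurable_fun A f ->
  measurable_fun (T @^-1` A : set (plane R)) (f \o T).
Proof.
move=> mA mf; apply: (@measurable_comp _ _ _ _ _ _ A) => //.
- by move=> _ [x Ax <-].
- by apply: measurable_funTS; exact: (@measurable_shear R a b c).
Qed.

Lemma ge0_integral_shear_in (A : set (plane R)) (f : R * R -> \bar R) :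
  measurable A -> measurable_fun A f -> (forall x, A x -> (0 <= f x)%E) ->
  (\int[@lebesgue2 R]_(x in T @^-1` A) f (T x) =
   (a * c)^-1%:E * \int[@lebesgue2 R]_(x in A) f x)%E.
Proof.
move=> mA mf f0; rewrite integral_mkcond [in RHS]integral_mkcond.
rewrite -(@ge0_integral_shear R a b c)//.
- by apply: (measurable_restrictT f mA).1.
- by move=> x; rewrite patchE; case: ifPn => // /set_mem /f0.
Qed.

Lemma Rintegral_shear_in (A : set (plane R)) (f : R * R -> R) :
  measurable A -> (@lebesgue2 R).-integrable A (EFin \o f) ->
  \int[@lebesgue2 R]_(x in T @^-1` A) f (T x) =
   (a * c)^-1 * \int[@lebesgue2 R]_(x in A) f x.
Proof.
move=> mA fi; rewrite /Rintegral.
have mf := measurable_int _ fi.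
rewrite integralE [in RHS]integralE.
rewrite (_ : (fun x => (f (T x))%:E)^\+%E = (EFin \o f)^\+%E \o T); last first.
  by rewrite -funepos_comp.
rewrite (_ : (fun x => (f (T x))%:E)^\-%E = (EFin \o f)^\-%E \o T); last first.
  by rewrite -funeneg_comp.
rewrite !ge0_integral_shear_in//; [|exact: measurable_funeneg|exact: measurable_funepos].
have p := integrable_pos_fin_num mA fi.
have n := integrable_neg_fin_num mA fi.
transitivity (fine ((a * c)^-1%:E * \int[lebesgue2 R]_(x in A) (EFin \o f)^\+ x -
  (a * c)^-1%:E * \int[lebesgue2 R]_(x in A) (EFin \o f)^\- x)%E); first by [].
transitivity ((a * c)^-1 * fine (\int[lebesgue2 R]_(x in A) (EFin \o f)^\+ x -
  \int[lebesgue2 R]_(x in A) (EFin \o f)^\- x)%E); last by [].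
by rewrite -(fineK p) -(fineK n) -!EFinM -!EFinB /= mulrBr.
Qed.

Lemma sqnorm_shear (A : set (plane R)) (u : R * R -> R) :
  measurable A -> measurable_fun A u ->
  (sqnorm (T @^-1` A) (u \o T) = (a * c)^-1%:E * sqnorm A u)%E.
Proof.
move=> mA mu; rewrite /sqnorm /= -(@ge0_integral_shear_in A (fun x => (u x ^+ 2)%:E))//.
- exact/measurable_EFinP/measurable_funX.
- by move=> x _; rewrite lee_fin sqr_ge0.
Qed.

Lemma in_L2_shear (A : set (plane R)) (u : R * R -> R) : measurable A ->
  in_L2 A u -> in_L2 (T @^-1` A) (u \o T).
Proof.
move=> mA [mu u2]; split; first exact: measurable_fun_shear.
by rewrite sqnorm_shear// lte_mul_pinfty// lee_fin invr_ge0 mulr_ge0// ltW.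
Qed.

End ShearIntegral.

Lemma ae_imply (R : realType) (P Q : R * R -> Prop) : (forall x, P x -> Q x) ->
  {ae @lebesgue2 R, forall x, P x} -> {ae @lebesgue2 R, forall x, Q x}.
Proof. by move=> PQ; apply: negligibleS => x /= nQ /PQ. Qed.

(** * Square integrable functions *)

Section L2.
Variables (R : realType) (A : set (plane R)).
Hypothesis mA : measurable A.
Implicit Types (u v : R * R -> R).

Lemma sqnorm_ge0 u : (0 <= sqnorm A u)%E.
Proof. by apply: integral_ge0 => x _; rewrite lee_fin sqr_ge0. Qed.

Lemma sqnorm_fin u : in_L2 A u -> sqnorm A u \is a fin_num.
Proof. by case=> _ u2; rewrite ge0_fin_numE// sqnorm_ge0. Qed.

(** Turns statements about null sets into statements about norms, which the
    change of variables transports. *)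
Lemma sqnorm_eq0 u : measurable_fun A u -> (sqnorm A u = 0 <-> ae_zero A u)%E.
Proof.
move=> mu; rewrite /sqnorm /ae_zero.
have mu2 : measurable_fun A (fun x => (u x ^+ 2)%:E).
  exact/measurable_EFinP/measurable_funX.
have := ae_eq_integral_abs (@lebesgue2 R) mA mu2.
under eq_integral do rewrite gee0_abs ?lee_fin ?sqr_ge0//.
move=> ->; split; apply: ae_imply => x /= + Ax => /(_ Ax).
  by move=> [] /eqP; rewrite sqrf_eq0 => /eqP.
by move=> ->; rewrite expr0n.
Qed.

Lemma sqnorm_ae_eq u v : measurable_fun A u -> measurable_fun A v ->
  ae_zero A (u \- v) -> sqnorm A u = sqnorm A v.
Proof.
move=> mu mv uv; apply: ae_eq_integral => //.
- exact/measurable_EFinP/measurable_funX.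
- exact/measurable_EFinP/measurable_funX.
apply: ae_imply uv => x /= + Ax => /(_ Ax) /eqP.
by rewrite subr_eq0 => /eqP ->.
Qed.

Lemma integrable_sqr u : in_L2 A u ->
  (@lebesgue2 R).-integrable A (fun x => (u x ^+ 2)%:E).
Proof.
move=> [mu u2]; apply/integrableP; split.
  exact/measurable_EFinP/measurable_funX.
under eq_integral do rewrite gee0_abs ?lee_fin ?sqr_ge0//.
exact: u2.
Qed.

Lemma in_L2_le u v w : measurable_fun A u -> in_L2 A v -> in_L2 A w ->
  (forall x, A x -> u x ^+ 2 <= v x ^+ 2 + w x ^+ 2) -> in_L2 A u.
Proof.
move=> mu v2 w2 uvw; split => //.
have := integrableD mA (integrable_sqr v2) (integrable_sqr w2).
move=> /integrableP[mi]; apply: le_lt_trans.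
apply: ge0_le_integral => //=.
- by move=> x _; rewrite lee_fin sqr_ge0.
- exact/measurable_EFinP/measurable_funX.
- apply/measurable_EFinP; apply: measurableT_comp => //.
  by apply: measurable_funD; apply: measurable_funX; [exact: v2.1|exact: w2.1].
- move=> x Ax; rewrite lee_fin; apply: le_trans (ler_norm _).
  exact: uvw.
Qed.

Lemma in_L2Z k u : in_L2 A u -> in_L2 A (fun x => k * u x).
Proof.
move=> [mu u2]; split.
  by apply: measurable_funM => //; exact: measurable_cst.
rewrite /sqnorm; under eq_integral do rewrite exprMn EFinM.
rewrite ge0_integralZl//=.
- by rewrite lte_mul_pinfty// lee_fin sqr_ge0.
- exact/measurable_EFinP/measurable_funX.
- by move=> x _; rewrite lee_fin sqr_ge0.
- by rewrite lee_fin sqr_ge0.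
Qed.

Lemma in_L2D u v : in_L2 A u -> in_L2 A v -> in_L2 A (fun x => u x + v x).
Proof.
move=> u2 v2; apply: (in_L2_le _ (in_L2Z 2 u2) (in_L2Z 2 v2)).
  by apply: measurable_funD; [exact: u2.1|exact: v2.1].
move=> x _; have := sqr_ge0 (u x - v x); have := sqr_ge0 (u x); have := sqr_ge0 (v x).
nra.
Qed.

Lemma in_L2B u v : in_L2 A u -> in_L2 A v -> in_L2 A (u \- v).
Proof.
move=> u2 v2; have := in_L2D u2 (in_L2Z (-1) v2).
by congr in_L2; apply/funext => x /=; rewrite mulN1r.
Qed.

Lemma in_L2_cst0 : in_L2 A (cst 0).
Proof.
split; first exact: measurable_cst.
by rewrite /sqnorm integral0_eq// => x _; rewrite expr0n.
Qed.

Lemma integrable_mul u v : in_L2 A u -> in_L2 A v ->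
  (@lebesgue2 R).-integrable A (EFin \o (fun x => u x * v x)).
Proof.
move=> u2 v2.
apply: (le_integrable mA _ _ (integrableD mA (integrable_sqr u2) (integrable_sqr v2))).
  by apply/measurable_EFinP/measurable_funM; [exact: u2.1|exact: v2.1].
move=> x Ax /=; rewrite lee_fin [leRHS]ger0_norm ?addr_ge0 ?sqr_ge0//.
rewrite normrM; have := sqr_ge0 (`|u x| - `|v x|).
have := real_normK (num_real (u x)); have := real_normK (num_real (v x)).
have := sqr_ge0 (u x); have := sqr_ge0 (v x); nra.
Qed.

End L2.

(** * Functions with continuous partial derivatives *)

Section DirectionalDerivative.
Variable R : realType.
Implicit Types (f g : R * R -> R) (x v : R * R).

Lemma is_derive_cvgP f x v (d : R) :
  is_derive x v f d <->
  (fun h : R => h^-1 *: (f (h *: v + x) - f x)) @ 0^' --> d.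
Proof.
split=> [[df <-]|fd]; first exact: df.
by apply: DeriveDef; [apply/cvg_ex; exists d|exact: cvg_lim].
Qed.

(** Brings directional derivatives down to one variable, where the mean value
    theorem is available. *)
Lemma is_derive_line f x v (t : R) :
  derivable f (t *: v + x) v ->
  is_derive t (1 : R) (fun s : R => f (s *: v + x)) ('D_v f (t *: v + x)).
Proof.
move=> df.
have E (h : R) : (h *: (1 : R) + t) *: v + x = h *: v + (t *: v + x).
  by rewrite scalerDl addrA [h *: 1]mulr1.
have eqf : (fun h : R => h^-1 *:
    (((fun s : R => f (s *: v + x)) \o shift t) (h *: (1 : R)) - f (t *: v + x))) =
  (fun h : R => h^-1 *: ((f \o shift (t *: v + x)) (h *: v) - f (t *: v + x))).
  by apply/funext => h /=; rewrite E.
by apply: DeriveDef; rewrite /derivable /derive eqf.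
Qed.

(** The increment [tau] may have either sign: the lemma is used along
    increments tending to zero from both sides. *)
Lemma MVT_line f x v (tau : R) : (forall y, derivable f y v) ->
  exists s : R, `|s| <= `|tau| /\ f (tau *: v + x) - f x = tau * 'D_v f (s *: v + x).
Proof.
move=> df.
pose g (s : R) := f (s *: v + x).
have dg s : is_derive s (1 : R) g ('D_v f (s *: v + x)) by exact: is_derive_line.
have cg (i : interval R) : {within [set` i], continuous g}.
  by apply: derivable_within_continuous => s _; case: (dg s).
have -> : f x = g 0 by rewrite /g scale0r add0r.
rewrite -/(g tau).
have [t0|t0] := leP 0 tau.
  have [s + ->] := MVT_segment t0 (fun s _ => dg s) (cg _).
  rewrite in_itv/= => /andP[s0 st]; exists s; split; first by rewrite !ger0_norm.
  by rewrite subr0 mulrC.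
have [s + e] := MVT_segment (ltW t0) (fun s _ => dg s) (cg _).
rewrite in_itv/= => /andP[s0 st]; exists s; split; first by rewrite !ler0_norm ?lerN2// ltW.
by rewrite -opprB e sub0r mulrN opprK mulrC.
Qed.

(** The increment is split into a horizontal and a vertical one; the mean value
    theorem turns each into a value of a partial derivative, at a point which
    tends to [x] with the increment. *)
Lemma is_derive_partials f (x : R * R) (b c : R) :
  (forall y, derivable f y (e1 R)) -> (forall y, derivable f y (e2 R)) ->
  {for x, continuous ('D_(e1 R) f)} -> {for x, continuous ('D_(e2 R) f)} ->
  is_derive x ((b, c) : R * R) f (b * 'D_(e1 R) f x + c * 'D_(e2 R) f x).
Proof.
move=> d1 d2 c1 c2; apply/is_derive_cvgP.
have [q qP] := choice (fun h : R => MVT_line x (h * b) d1).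
have [p pP] := choice (fun h : R => MVT_line (h * b *: e1 R + x) (h * c) d2).
have small k (r : R -> R) : (forall h, `|r h| <= `|h * k|) ->
    r h @[h --> (0:R)^'] --> (0:R).
  move=> rk; have hk : (h * k) @[h --> (0:R)^'] --> (0:R).
    apply: cvg_within_filter.
    have : (fun h : R => h * k) @ (0 : R) --> 0 * k by apply: cvgMr_tmp; exact: cvg_id.
    by rewrite mul0r.
  apply/cvgr0Pnorm_lt => e e0; have /cvgr0Pnorm_lt/(_ _ e0) := hk.
  by apply: filterS => h; exact: le_lt_trans.
have q0 := small _ _ (fun h => (qP h).1).
have p0 := small _ _ (fun h => (pP h).1).
have b0 : h * b @[h --> (0:R)^'] --> (0:R) by exact: (small b).
apply: (@cvg_trans _ ((fun h : R => b * 'D_(e1 R) f (q h *: e1 R + x) +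
  c * 'D_(e2 R) f (p h *: e2 R + ((h * b) *: e1 R + x))) @ 0^')).
  apply: near_eq_cvg; near=> h.
  have h0 : h != 0 by near: h; exact: nbhs_dnbhs_neq.
  have -> : h *: ((b, c) : R * R) + x =
      (h * c) *: e2 R + ((h * b) *: e1 R + x).
    by congr pair; rewrite /= ?[_ *: 1]mulr1 ?[_ *: 0]mulr0 ?add0r.
  have -> : f ((h * c) *: e2 R + (h * b *: e1 R + x)) - f x =
    (f ((h * c) *: e2 R + (h * b *: e1 R + x)) - f (h * b *: e1 R + x)) +
    (f (h * b *: e1 R + x) - f x) by rewrite [RHS]addrA subrK.
  rewrite (pP h).2 (qP h).2 scalerDr -!mulrA addrC.
  by congr (_ + _); rewrite [RHS]mulKf.
have lim (r : R -> R) v : r h @[h --> (0:R)^'] --> (0:R) ->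
    r h *: v @[h --> (0:R)^'] --> (0 : R * R).
  move=> r0; have : r h *: v @[h --> (0:R)^'] --> 0 *: v by exact: cvgZr_tmp.
  by rewrite scale0r.
apply: cvgD; apply: cvgMl_tmp.
  apply: (continuous_cvg _ c1).
  have : q h *: e1 R + x @[h --> (0:R)^'] --> 0 + x.
    by apply: cvgD; [exact: lim|exact: cvg_cst].
  by rewrite add0r.
apply: (continuous_cvg _ c2).
have : p h *: e2 R + (h * b *: e1 R + x) @[h --> (0:R)^'] --> 0 + (0 + x).
  by apply: cvgD; [exact: lim|apply: cvgD; [exact: lim|exact: cvg_cst]].
by rewrite !add0r.
Unshelve. all: by end_near. Qed.

End DirectionalDerivative.

Section CkTheory.
Variable R : realType.
Implicit Types (f g : R * R -> R) (k : nat).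

Lemma Ck_continuous k f : Ck k f -> continuous f.
Proof. by case: k => //= k []. Qed.

Lemma CkS k f : Ck k.+1 f -> Ck k f.
Proof.
elim: k f => [|k IH] f [cf df d1 d2]; first exact: cf.
by split; [exact: cf|exact: df|exact: IH d1|exact: IH d2].
Qed.

Lemma Ck_cst k (r : R) : Ck k (cst r : R * R -> R).
Proof.
elim: k r => [|k IH] r; first by move=> x; exact: cvg_cst.
have D v : 'D_v (cst r : R * R -> R) = cst 0.
  by apply/funext => x; exact: derive_cst.
split; rewrite ?D; [|move=> x; split|exact: IH|exact: IH].
- by move=> x; exact: cvg_cst.
- exact: derivable_cst.
- exact: derivable_cst.
Qed.

Lemma CkD k f g : Ck k f -> Ck k g -> Ck k (f + g).
Proof.
elim: k f g => [|k IH] f g.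
  by move=> cf cg x; apply: cvgD; [exact: cf|exact: cg].
move=> [cf df f1 f2] [cg dg g1 g2].
have D1 : 'D_(e1 R) (f + g) = 'D_(e1 R) f + 'D_(e1 R) g.
  by apply/funext => x; rewrite deriveD//; [exact: (df x).1|exact: (dg x).1].
have D2 : 'D_(e2 R) (f + g) = 'D_(e2 R) f + 'D_(e2 R) g.
  by apply/funext => x; rewrite deriveD//; [exact: (df x).2|exact: (dg x).2].
split; [|move=> x; split|..].
- by move=> x; apply: cvgD; [exact: cf|exact: cg].
- by apply: derivableD; [exact: (df x).1|exact: (dg x).1].
- by apply: derivableD; [exact: (df x).2|exact: (dg x).2].
- by rewrite D1; exact: IH.
- by rewrite D2; exact: IH.
Qed.

Lemma CkM k f g : Ck k f -> Ck k g -> Ck k (f * g).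
Proof.
elim: k f g => [|k IH] f g.
  by move=> cf cg x; apply: cvgM; [exact: cf|exact: cg].
move=> fk gk; have := CkS fk; have := CkS gk; move: fk gk.
move=> [cf df f1 f2] [cg dg g1 g2] gk fk.
have D1 : 'D_(e1 R) (f * g) = f * 'D_(e1 R) g + g * 'D_(e1 R) f.
  by apply/funext => x; rewrite deriveM//; [exact: (df x).1|exact: (dg x).1].
have D2 : 'D_(e2 R) (f * g) = f * 'D_(e2 R) g + g * 'D_(e2 R) f.
  by apply/funext => x; rewrite deriveM//; [exact: (df x).2|exact: (dg x).2].
split; [|move=> x; split|..].
- by move=> x; apply: cvgM; [exact: cf|exact: cg].
- by apply: derivableM; [exact: (df x).1|exact: (dg x).1].
- by apply: derivableM; [exact: (df x).2|exact: (dg x).2].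
- by rewrite D1; apply: CkD; exact: IH.
- by rewrite D2; apply: CkD; exact: IH.
Qed.

Lemma CkZ k (r : R) f : Ck k f -> Ck k (fun x => r * f x).
Proof. by move=> fk; apply: (CkM (Ck_cst k r) fk). Qed.

Lemma Ck1_is_derive f (x : R * R) (b c : R) : Ck 1 f ->
  is_derive x ((b, c) : R * R) f (b * 'D_(e1 R) f x + c * 'D_(e2 R) f x).
Proof.
move=> [_ df c1 c2]; apply: is_derive_partials.
- by move=> y; exact: (df y).1.
- by move=> y; exact: (df y).2.
- exact: c1.
- exact: c2.
Qed.

Lemma continuous_affine (p q r : R) :
  continuous (fun x : R * R => p * x.1 + q * x.2 + r).
Proof.
move=> x; apply: cvgD; last exact: cvg_cst.
by apply: cvgD; apply: cvgMl_tmp; [exact: cvg_fst|exact: cvg_snd].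
Qed.

Lemma continuous_shear (a b c : R) : continuous (shear a b c).
Proof.
move=> x; apply: (@cvg_pair _ _ _ (nbhs x) (nbhs _) (nbhs _)) => /=.
  have := @continuous_affine a b 0 x.
  by rewrite /continuous_at addr0; under eq_fun do rewrite addr0.
have := @continuous_affine 0 c 0 x.
by rewrite /continuous_at addr0 mul0r add0r; under eq_fun do rewrite addr0 mul0r add0r.
Qed.

Lemma shear_linear (a b c h : R) (v x : R * R) :
  shear a b c (h *: v + x) = h *: shear a b c v + shear a b c x.
Proof.
case: v x => [v1 v2] [x1 x2]; rewrite /shear /=.
by congr pair; rewrite /= /GRing.scale/=; ring.
Qed.

Lemma is_derive_comp_shear (a b c : R) f (x v : R * R) (d : R) :
  is_derive (shear a b c x) (shear a b c v) f d ->
  is_derive x v (f \o shear a b c) d.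
Proof.
move/is_derive_cvgP => fd; apply/is_derive_cvgP.
by under eq_fun do rewrite /= shear_linear.
Qed.

Lemma derive_shear (a b c : R) f : Ck 1 f ->
  (forall x, derivable (f \o shear a b c) x (e1 R) /\
             derivable (f \o shear a b c) x (e2 R)) /\
  'D_(e1 R) (f \o shear a b c) = (fun x => a * 'D_(e1 R) f (shear a b c x)) /\
  'D_(e2 R) (f \o shear a b c) =
    (fun x => b * 'D_(e1 R) f (shear a b c x) + c * 'D_(e2 R) f (shear a b c x)).
Proof.
move=> f1.
have d1 x : is_derive x (e1 R) (f \o shear a b c) (a * 'D_(e1 R) f (shear a b c x)).
  apply: is_derive_comp_shear; rewrite /shear /= !mulr1 !mulr0 addr0.
  by have := Ck1_is_derive (shear a b c x) a 0 f1; rewrite mul0r addr0.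
have d2 x : is_derive x (e2 R) (f \o shear a b c)
    (b * 'D_(e1 R) f (shear a b c x) + c * 'D_(e2 R) f (shear a b c x)).
  apply: is_derive_comp_shear; rewrite /shear /= !mulr1 !mulr0 add0r.
  exact: Ck1_is_derive.
split; first by move=> x; split; [case: (d1 x)|case: (d2 x)].
by split; apply/funext => x; [case: (d1 x)|case: (d2 x)].
Qed.

(** The partial derivatives of [f o T] are combinations of those of [f] composed
    with [T], so the claim for [k] passes to [k + 1]. *)
Lemma Ck_comp_shear k (a b c : R) f : Ck k f -> Ck k (f \o shear a b c).
Proof.
elim: k f => [|k IH] f fk.
  by move=> x; apply: continuous_comp; [exact: continuous_shear|exact: fk].
have f1 : Ck 1 f.
  case: fk => cf df d1 d2.
  by split; [exact: cf|exact: df|exact: Ck_continuous d1|exact: Ck_continuous d2].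
have [d [D1 D2]] := derive_shear a b c f1.
case: fk => cf df d1 d2; split; [|exact: d|..].
- by move=> x; apply: continuous_comp; [exact: continuous_shear|exact: cf].
- by rewrite D1; exact: (CkZ _ (IH _ d1)).
- by rewrite D2; exact: (CkD (CkZ _ (IH _ d1)) (CkZ _ (IH _ d2))).
Qed.

Fixpoint Ck1d k (g : R -> R) : Prop :=
  if k is k'.+1 then (forall x, derivable g x 1) /\ Ck1d k' (g^`())%classic else continuous g.

(** Smooth functions of one variable are the only source of smooth functions on
    the plane used below, through products of such composites. *)
Lemma Ck_comp_affine k (g : R -> R) (p q r : R) : Ck1d k g ->
  Ck k (fun x : R * R => g (p * x.1 + q * x.2 + r)).
Proof.
have caff := @continuous_affine p q r.
elim: k g => [|k IH] g.
  move=> cg x; apply: (@continuous_comp _ _ _ (fun x : R * R => p * x.1 + q * x.2 + r)).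
    exact: caff.
  exact: cg.
move=> [dg gk].
have D (x v : R * R) : is_derive x v (fun x : R * R => g (p * x.1 + q * x.2 + r))
   ((p * v.1 + q * v.2) * (g^`())%classic (p * x.1 + q * x.2 + r)).
  pose m := p * v.1 + q * v.2; pose y := p * x.1 + q * x.2 + r.
  have dl : is_derive (0 : R) (1 : R) (fun h : R => m * h + y) m.
    have := is_deriveD (is_deriveZ (m : R) (is_derive_id (0 : R) (1 : R)))
      (is_derive_cst y (0 : R) (1 : R)).
    by move=> H; apply: is_derive_eq H _; rewrite addr0 [_ *: _]mulr1.
  have dgy : is_derive (m * 0 + y) (1 : R) g ((g^`())%classic (m * 0 + y)).
    by rewrite derive1E; exact: derivableP.
  have [dF vF] := @is_derive1_comp R g (fun h : R => m * h + y) 0 _ _ dgy dl.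
  apply/is_derive_cvgP; rewrite -/m -/y [m * _]mulrC.
  rewrite mulr0 add0r in vF; rewrite -[X in _ --> X]vF.
  rewrite (_ : (fun h : R => _) = (fun h : R => h^-1 *:
    (((g \o (fun h : R => m * h + y)) \o shift 0) (h *: (1 : R)) -
     (g \o (fun h : R => m * h + y)) 0))); first exact: dF.
  apply/funext => h /=; rewrite mulr0 add0r addr0 [h *: 1]mulr1 -/y.
  congr (_ *: (g _ - _)); rewrite /m /y /= /GRing.scale /=; ring.
split.
- move=> x; apply: (@continuous_comp _ _ _ (fun x : R * R => p * x.1 + q * x.2 + r)).
    exact: caff.
  by apply: differentiable_continuous; exact/derivable1_diffP.
- by move=> x; split; [case: (D x (e1 R))|case: (D x (e2 R))].
- rewrite (_ : 'D_(e1 R) _ = fun x => p * (g^`())%classic (p * x.1 + q * x.2 + r)).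
    by apply: CkZ; exact: IH.
  by apply/funext => x; case: (D x (e1 R)) => _ ->; rewrite /= mulr1 mulr0 addr0.
- rewrite (_ : 'D_(e2 R) _ = fun x => q * (g^`())%classic (p * x.1 + q * x.2 + r)).
    by apply: CkZ; exact: IH.
  by apply/funext => x; case: (D x (e2 R)) => _ ->; rewrite /= mulr1 mulr0 add0r.
Qed.

End CkTheory.

(** * Boxes and the Borel structure of the plane *)

Section Boxes.
Variable R : realType.

Definition box (a b c d : R) : set (R * R) := `]a, b[%classic `*` `]c, d[%classic.
Definition cbox (a b c d : R) : set (R * R) := `[a, b]%classic `*` `[c, d]%classic.

Lemma measurable_box (a b c d : R) : measurable (box a b c d : set (plane R)).
Proof. by apply: measurableX; exact: measurable_itv. Qed.

Lemma box_subset_cbox (a b c d : R) : box a b c d `<=` cbox a b c d.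
Proof.
move=> x [/= ]; rewrite !in_itv/= => /andP[? ?] /andP[? ?].
by split; rewrite /= in_itv/=; apply/andP; split; exact: ltW.
Qed.

Lemma lebesgue2_box_lty (a b c d : R) : (@lebesgue2 R (box a b c d) < +oo)%E.
Proof.
rewrite /lebesgue2 /= product_measure1E; [|exact: measurable_itv..].
have fi (x y : R) : (lebesgue_measure (`]x, y[%classic : set R) < +oo)%E.
  by rewrite lebesgue_measure_itv/=; case: ifP => _; rewrite -?EFinB ltry.
by rewrite lte_mul_pinfty//; [rewrite ge0_fin_numE//; exact: fi|exact: fi].
Qed.

Lemma open_rat_box (U : set (R * R)) (x : R * R) : open U -> U x ->
  exists p q r s : rat, box (ratr p) (ratr q) (ratr r) (ratr s) x /\
    cbox (ratr p) (ratr q) (ratr r) (ratr s) `<=` U.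
Proof.
move=> oU Ux; have : nbhs x U by exact: open_nbhs_nbhs.
rewrite -nbhs_ballE => -[e /= e0 eU].
have lo (y : R) : exists p : rat, y - e < ratr p < y.
  by have [p] := @rat_in_itvoo R (y - e) y (ltac:(lra)); rewrite in_itv/=; exists p.
have hi (y : R) : exists p : rat, y < ratr p < y + e.
  by have [p] := @rat_in_itvoo R y (y + e) (ltac:(lra)); rewrite in_itv/=; exists p.
have [p /andP[p1 p2]] := lo x.1; have [q /andP[q1 q2]] := hi x.1.
have [r /andP[r1 r2]] := lo x.2; have [s /andP[s1 s2]] := hi x.2.
exists p, q, r, s; split.
  by split; rewrite /= in_itv/=; apply/andP.
move=> y [/=]; rewrite !in_itv/= => /andP[y1 y2] /andP[y3 y4].
apply: eU; split; rewrite /ball/= ltr_norml; apply/andP; split; lra.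
Qed.

(** Open sets are handled through the rational boxes whose closure they contain:
    there are countably many of them, and each leaves room for test functions
    that do not vanish anywhere on it.  Codes of other boxes stand for the empty
    set. *)
Definition inner_box (U : set (R * R)) (n : nat) : set (R * R) :=
  if unpickle n is Some (p, q, r, s) then
    if `[< cbox (ratr p) (ratr q) (ratr r) (ratr s) `<=` U >] then
      box (ratr p) (ratr q) (ratr r) (ratr s) else set0
  else set0.

Lemma open_bigcup_inner_box (U : set (R * R)) :
  open U -> U = \bigcup_n inner_box U n.
Proof.
move=> oU; apply/seteqP; split => x; last first.
  move=> [n _]; rewrite /inner_box; case: unpickle => [[[[p q] r] s]|]//.
  by case: asboolP => // sU /box_subset_cbox/sU.
move=> Ux; have [p [q [r [s [bx sU]]]]] := open_rat_box oU Ux.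
exists (pickle (p, q, r, s)); first exact: Logic.I.
by rewrite /inner_box pickleK (asboolT sU).
Qed.

Lemma open_measurable2 (U : set (R * R)) : open U -> measurable (U : set (plane R)).
Proof.
move=> /open_bigcup_inner_box ->; apply: bigcupT_measurable => n.
rewrite /inner_box; case: unpickle => [[[[p q] r] s]|]//.
by case: ifP => _ //; exact: measurable_box.
Qed.

Lemma continuous_measurable2 (f : R * R -> R) : continuous f ->
  measurable_fun (setT : set (plane R)) f.
Proof.
move=> /continuousP cf; apply: (measurability _ (RGenOpens.measurableE R)).
move=> _ [_ [a [b ->] <-]]; rewrite setTI; apply: open_measurable2.
exact/cf/interval_open.
Qed.

End Boxes.

(** * Compactly supported functions and integration by parts *)

Section CompactSupport.
Variable R : realType.
Implicit Types (f g : R * R -> R) (A : set (plane R)).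

Lemma support_in f x : f x != 0 -> support f x.
Proof. by move=> fx; exact: subset_closure. Qed.

Lemma support_out f x : ~ support f x -> f x = 0.
Proof.
by move=> nx; apply/eqP/negPn/negP => fx; exact/nx/support_in.
Qed.

Lemma compact_support_box f : compact (support f) ->
  exists2 M : R, 0 < M & support f `<=` box (- M) M (- M) M.
Proof.
move=> /compact_bounded [M [_ HM]]; exists (`|M| + 2); first by rewrite ltr_wpDl.
move=> x sx; have MM : M < `|M| + 1 by rewrite ltr_pwDr// ler_norm.
have : `|x| <= `|M| + 1 by exact: (HM _ MM _ sx).
rewrite prod_normE ge_max => /andP[x1 x2].
by split; rewrite /= in_itv/= -ltr_norml; lra.
Qed.

Lemma bounded_compact_support f : continuous f -> compact (support f) ->
  exists K, forall x, `|f x| <= K.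
Proof.
move=> cf sf.
have /compact_bounded [K [_ HK]] : compact (f @` support f).
  by apply: continuous_compact => //; exact: continuous_subspaceT.
exists (`|K| + 1) => x.
have KK : K < `|K| + 1 by rewrite ltr_pwDr// ler_norm.
have [sx|/support_out ->] := pselect (support f x); last by rewrite normr0 addr_ge0.
by apply: (HK _ KK); exists x.
Qed.

Lemma integrable_compact_support f A : measurable A ->
  continuous f -> compact (support f) -> (@lebesgue2 R).-integrable A (EFin \o f).
Proof.
move=> mA cf sf; have [M M0 HM] := compact_support_box sf.
have [K HK] := bounded_compact_support cf sf.
apply: (integrableS measurableT) => //.
have -> : EFin \o f = (EFin \o f) \_ (box (- M) M (- M) M).
  apply/funext => x; rewrite patchE; case: ifPn => // /negP; rewrite inE => nx.
  by have [fx|/support_in/HM//] := eqVneq (f x) 0; rewrite /= fx.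
apply/(integrable_restrict _ (measurable_box _ _ _ _) measurableT); rewrite setTI.
apply: measurable_bounded_integrable.
- exact: measurable_box.
- exact: lebesgue2_box_lty.
- by apply: measurable_funTS; exact: continuous_measurable2.
- exists K; split; first exact: num_real.
  by move=> K' KK' x _ /=; rewrite (le_trans (HK x))// ltW.
Qed.

Lemma in_L2_compact_support f A : measurable A ->
  continuous f -> compact (support f) -> in_L2 A f.
Proof.
move=> mA cf sf; split.
  by apply: measurable_funTS; exact: continuous_measurable2.
have := @integrable_compact_support (fun x => f x ^+ 2) A mA.
have -> : support (fun x => f x ^+ 2) = support f.
  by congr closure; apply/seteqP; split => x /=; rewrite sqrf_eq0.
move=> H; have cf2 : continuous (fun x => f x ^+ 2).
  by move=> x; apply: cvgM; exact: cf.
exact: integrable_lty (H cf2 sf).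
Qed.

End CompactSupport.

Section TestFunctions.
Variable R : realType.
Implicit Types (f g phi chi : R * R -> R) (A : set (plane R)) (v : R * R).

Lemma near_out_support f x : ~ support f x -> \forall y \near x, f y = 0.
Proof.
move=> nx; have oS : open (~` support f) by apply: closed_openC; exact: closed_closure.
by apply: filterS (open_nbhs_nbhs (conj oS nx)) => y; exact: support_out.
Qed.

(** Away from its support a function vanishes on a neighbourhood, hence so do
    its derivatives. *)
Lemma support_derive f v : support ('D_v f) `<=` support f.
Proof.
have cS : closed (support f) by exact: closed_closure.
rewrite [X in _ `<=` X]((closure_id _).1 cS).
apply: closureS => x /= Dx; apply: contrapT => /near_out_support nx.
move/eqP: Dx; apply.
by rewrite (near_eq_derive v (g := cst 0) nx) derive_cst.
Qed.

Lemma supportM f g : support (fun x => f x * g x) `<=` support g.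
Proof.
by apply: closureS => x /=; rewrite mulf_eq0 negb_or => /andP[].
Qed.

Lemma compact_support_sub f g : compact (support g) -> support f `<=` support g ->
  compact (support f).
Proof. by move=> cg fg; apply: subclosed_compact cg fg; exact: closed_closure. Qed.

Lemma smooth_continuous f : smooth f -> continuous f.
Proof. by move=> sf; exact: (sf 0%N). Qed.

Definition axis v := v = e1 R \/ v = e2 R.

Lemma smooth_derivable f v : axis v -> smooth f -> forall x, derivable f x v.
Proof. by move=> [->|->] sf x; have [_ /(_ x)[]] := sf 1%N. Qed.

Lemma smooth_derive f v : axis v -> smooth f -> smooth ('D_v f).
Proof. by move=> [->|->] sf k; have [] := sf k.+1. Qed.

Lemma test_function_derive f v (A : set (R * R)) : axis v ->
  test_function A f -> test_function A ('D_v f).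
Proof.
move=> vA [sf cf fA]; split; first exact: smooth_derive.
- exact: compact_support_sub cf (@support_derive f v).
- exact: subset_trans (@support_derive f v) fA.
Qed.

Lemma test_function_subset f (A B : set (R * R)) : A `<=` B ->
  test_function A f -> test_function B f.
Proof. by move=> AB [? ? fA]; split => //; exact: subset_trans AB. Qed.

Lemma test_functionM f g (A : set (R * R)) : smooth f -> test_function A g ->
  test_function A (f * g).
Proof.
move=> sf [sg cg gA]; split; first by move=> k; apply: CkM; [exact: sf|exact: sg].
- exact: compact_support_sub cg (@supportM f g).
- exact: subset_trans (@supportM f g) gA.
Qed.

Lemma test_function_in_L2 f (B : set (R * R)) A : measurable A ->
  test_function B f -> in_L2 A f.
Proof.
move=> mA [sf cf _]; apply: in_L2_compact_support => //.
exact: smooth_continuous.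
Qed.

Lemma integral_derive1d (F f : R -> R) (M : R) : 0 < M ->
  (forall t, derivable F t 1) -> F^`()%classic =1 f -> continuous f ->
  (forall t, F t != 0 -> - M < t < M) -> (forall t, f t != 0 -> - M < t < M) ->
  (\int[@lebesgue_measure R]_t (f t)%:E = 0)%E.
Proof.
move=> M0 dF Ff cf FM fM.
have -> : (\int[lebesgue_measure]_t (f t)%:E =
    \int[lebesgue_measure]_(t in `[(- M)%R, M%R]) (f t)%:E)%E.
  rewrite [RHS]integral_mkcond; apply: eq_integral => t _; rewrite patchE.
  case: ifPn => // /negP; rewrite inE/= in_itv/= => nt; congr (_%:E).
  have [//|/fM/andP[t1 t2]] := eqVneq (f t) 0.
  by exfalso; apply: nt; rewrite !ltW.
have out t : ~ (- M < t < M) -> F t = 0.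
  by move=> nt; have [//|/FM] := eqVneq (F t) 0.
have cF : continuous F by move=> t; exact/differentiable_continuous/derivable1_diffP.
rewrite (@continuous_FTC2 _ f F).
- have oM : F M = 0 by apply: out; rewrite ltxx andbF.
  have oM' : F (- M) = 0 by apply: out; rewrite ltxx.
  by rewrite oM oM' -EFinB subrr.
- lra.
- exact: continuous_subspaceT.
- split; [by move=> t _; exact: dF|exact/cvg_at_right_filter/cF|exact/cvg_at_left_filter/cF].
- by move=> t _; exact: Ff.
Qed.

(** On each line of direction [v] the integral is that of the derivative of a
    compactly supported function; Fubini concludes. *)
Lemma integral_derive_test phi v : axis v -> test_function setT phi ->
  (\int[@lebesgue2 R]_x ('D_v phi x)%:E = 0)%E.
Proof.
move=> vA tphi; have [sphi cphi _] := tphi.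
have tD := test_function_derive vA tphi.
have [sD cD _] := tD.
have iD := integrable_compact_support measurableT (smooth_continuous sD) cD.
have [M M0 HM0] := compact_support_box cphi.
have HM x : phi x != 0 -> box (- M) M (- M) M x by move/support_in/HM0.
have HD x : 'D_v phi x != 0 -> box (- M) M (- M) M x.
  by move=> Dx; apply/HM0/(@support_derive phi v)/(@support_in _ ('D_v phi) x Dx).
have line x t : is_derive t (1 : R) (fun s : R => phi (s *: v + x)) ('D_v phi (t *: v + x)).
  by apply: (@is_derive_line _ phi x v t); exact: (smooth_derivable vA sphi).
have line0 x : (forall s : R, phi (s *: v + x) != 0 -> - M < s < M) ->
  (forall s : R, 'D_v phi (s *: v + x) != 0 -> - M < s < M) ->
  (\int[@lebesgue_measure R]_s ('D_v phi (s *: v + x))%:E = 0)%E.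
  move=> H1 H2; apply: (@integral_derive1d (fun s : R => phi (s *: v + x))
    (fun s : R => 'D_v phi (s *: v + x)) M M0 _ _ _ H1 H2).
  - by move=> t; exact: (@ex_derive _ _ _ _ _ _ _ (line x t)).
  - by move=> t; rewrite derive1E; exact: (@derive_val _ _ _ _ _ _ _ (line x t)).
  - have c1 : continuous (fun s : R => s *: v + x).
      by move=> t; apply: cvgD; [apply: cvgZr_tmp; exact: cvg_id|exact: cvg_cst].
    move=> t; exact: (@continuous_comp _ _ _ (fun s : R => s *: v + x) ('D_v phi) t
      (c1 t) (@smooth_continuous ('D_v phi) sD (t *: v + x))).
case: vA => ve; rewrite ve in line0 HD iD *.
- rewrite /lebesgue2 -integral21_prod_meas1//.
  rewrite integral0_eq// => y _; rewrite /fubini_G /=.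
  rewrite -[RHS](line0 (0, y)).
  + apply: eq_integral => x _; rewrite (_ : x *: e1 R + (0, y) = (x, y))//.
    by congr pair; rewrite /= ?[_ *: 1]mulr1 ?[_ *: 0]mulr0 ?add0r ?addr0.
  + move=> s /HM[/= + _]; by rewrite in_itv/= addr0 [s *: 1]mulr1.
  + move=> s /HD[/= + _]; by rewrite in_itv/= addr0 [s *: 1]mulr1.
- rewrite /lebesgue2 -integral12_prod_meas1//.
  rewrite integral0_eq// => y _; rewrite /fubini_F /=.
  rewrite -[RHS](line0 (y, 0)).
  + apply: eq_integral => x _; rewrite (_ : x *: e2 R + (y, 0) = (y, x))//.
    by congr pair; rewrite /= ?[_ *: 1]mulr1 ?[_ *: 0]mulr0 ?add0r ?addr0.
  + move=> s /HM[/= _ +]; by rewrite in_itv/= addr0 [s *: 1]mulr1.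
  + move=> s /HD[/= _ +]; by rewrite in_itv/= addr0 [s *: 1]mulr1.
Qed.

(** The two integrands add up to the derivative of the test function
    [f * chi], whose integral over the plane vanishes and which is zero outside
    [A]. *)
Lemma Rintegral_by_parts f chi v A : axis v -> measurable A ->
  smooth f -> test_function A chi ->
  \int[@lebesgue2 R]_(x in A) (f x * 'D_v chi x) =
  - \int[@lebesgue2 R]_(x in A) ('D_v f x * chi x).
Proof.
move=> vA mA sf tchi.
have tD := test_function_derive vA tchi.
have sDf := smooth_derive vA sf.
have int g h : smooth g -> test_function A h ->
    (@lebesgue2 R).-integrable A (EFin \o (fun x => g x * h x)).
  move=> sg th; have [sgh cgh _] := test_functionM sg th.
  exact: integrable_compact_support (smooth_continuous sgh) cgh.
apply/eqP; rewrite -addr_eq0 -RintegralD//; [|exact: int..].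
have tp := test_functionM sf tchi.
have E : 'D_v (f * chi) = fun x => f x * 'D_v chi x + 'D_v f x * chi x.
  apply/funext => x; rewrite deriveM; [|apply: smooth_derivable vA _ _..].
  - by congr (_ + _); exact: mulrC.
  - exact: sf.
  - by case: tchi.
have I0 := integral_derive_test vA (test_function_subset (@subsetT _ _) tp).
rewrite -E /Rintegral integral_mkcond.
rewrite (_ : (fun x => ('D_v (f * chi) x)%:E) \_ A = fun x => ('D_v (f * chi) x)%:E).
  by rewrite I0.
apply/funext => x; rewrite patchE; case: ifPn => // /negP; rewrite inE => nA.
have [_ _ pA] := test_function_derive vA tp.
by rewrite (@support_out _ ('D_v (f * chi)) x)// => /pA.
Qed.

End TestFunctions.

(** * Smooth bumps *)

Section FlatExp.
Variable R : realType.
Implicit Types (P Q : {poly R}) (x t : R).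

(** The function [P(1/x) exp(-1/x)], extended by zero to the left of the origin.
    The family is closed under differentiation, so each member is smooth. *)
Definition flat P x : R := if 0 < x then P.[x^-1] * expR (- x^-1) else 0.

Lemma flatD P Q x : flat (P + Q) x = flat P x + flat Q x.
Proof. by rewrite /flat; case: ifP; rewrite ?addr0// hornerD mulrDl. Qed.

(** The exponential beats every power of [1/x].  This linear bound, applied to
    ['X * P], shows that the difference quotients of [flat P] at the origin tend
    to zero.  *)
Lemma flat_le P : exists C, forall x, `|flat P x| <= C * `|x|.
Proof.
(* each step of the induction trades a factor 'X of P for one in 'X^n *)
suff H n : exists C, forall x, `|flat (P * 'X^n) x| <= C * `|x|.
  by have := H 0%N; rewrite expr0 mulr1.
elim/poly_ind: P n => [|P c IH] n.
  by exists 0 => x; rewrite mul0r /flat horner0 mul0r if_same normr0 mul0r.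
have [C HC] := IH n.+1.
exists (C + `|c| * (n.+1)`!%:R) => x.
rewrite mulrDl -mulrA -exprS flatD (le_trans (ler_normD _ _))// mulrDl lerD//.
rewrite /flat; case: ifPn => [x0|_]; last by rewrite normr0 !mulr_ge0.
rewrite hornerM hornerC hornerXn !normrM -!mulrA ler_wpM2l//.
have xi0 : 0 <= x^-1 by rewrite invr_ge0 ltW.
rewrite (gtr0_norm x0) !ger0_norm ?expR_ge0 ?exprn_ge0//.
have := @expR_ge1Dxn R (x^-1) n (ltac:(by rewrite invr_ge0 ltW)).
rewrite expRN => E.
have e0 := expR_gt0 x^-1.
have f0 : 0 < n.+1`!%:R :> R by rewrite ltr0n fact_gt0.
rewrite ler_pdivrMr//.
have : x^-1 ^+ n.+1 <= n.+1`!%:R * expR x^-1.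
  rewrite mulrC -ler_pdivrMr//; apply: le_trans E; lra.
rewrite exprS => H.
have -> : x^-1 ^+ n = x * (x^-1 * x^-1 ^+ n) by rewrite mulrA divff ?gt_eqF// mul1r.
by rewrite mulrAC [leRHS]mulrC ler_pM2l.
Qed.

Definition dflat P : {poly R} := 'X ^+ 2 * (P - P^`()).

Lemma is_derive_flat P x : is_derive x (1 : R) (flat P) (flat (dflat P) x).
Proof.
have [x0|x0|->] := ltgtP x 0.
- have -> : flat (dflat P) x = 0 by rewrite /flat ltNge (ltW x0).
  apply: (@near_eq_is_derive R R R (cst 0) (flat P) x 1 0).
    by apply: filterS (lt_nbhsl x0) => y y0; rewrite /flat ltNge (ltW y0).
- pose f (y : R) := P.[y^-1] * expR (- y^-1).
  have nf : \forall y \near x, f y = flat P y.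
    by apply: filterS (lt_nbhsr x0) => y y0; rewrite /flat y0.
  suff df : is_derive x (1 : R) f (flat (dflat P) x) by exact: near_eq_is_derive nf df.
  have xn0 : x != 0 by rewrite gt_eqF.
  have dV : is_derive x (1 : R) (fun y : R => y^-1) (- x ^- 2 *: 1).
    exact: is_deriveV.
  have dP : is_derive x^-1 (1 : R) (horner P) (P^`().[x^-1]).
    apply: DeriveDef; first exact: derivable_horner.
    by rewrite -derive1E derivE.
  have dE : is_derive (- x^-1) (1 : R) expR (expR (- x^-1)) by exact: is_derive_expR.
  have d1 := @is_derive1_comp R (horner P) (fun y : R => y^-1) x _ _ dP dV.
  have d2 := @is_derive1_comp R expR (fun y : R => - y^-1) x _ _ dE (is_deriveN dV).
  apply: is_derive_eq (is_deriveM d1 d2) _.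
  rewrite /flat x0 /dflat !hornerE /GRing.scale /=.
  by field.
- have -> : flat (dflat P) 0 = 0 by rewrite /flat ltxx.
  have [C HC] := flat_le ('X * P).
  have H : (fun h : R => h^-1 *:
      ((flat P \o shift 0) (h *: (1 : R)) - flat P 0)) @ 0^' --> (0 : R).
    apply/cvgr0Pnorm_lt => e e0.
    near=> h.
    have -> : h^-1 *: ((flat P \o shift 0) (h *: (1 : R)) - flat P 0) = flat ('X * P) h.
      rewrite /= addr0 [h *: 1]mulr1 /flat ltxx subr0; case: ifP => _.
        by rewrite hornerM hornerX -mulrA.
      by rewrite scaler0.
    apply: le_lt_trans (HC h) _.
    apply: (@le_lt_trans _ _ ((`|C| + 1) * `|h|)).
      by rewrite ler_wpM2r// (le_trans (ler_norm C))// lerDl.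
    rewrite mulrC -ltr_pdivlMr ?ltr_wpDl//.
    by near: h; apply: dnbhs0_lt; rewrite divr_gt0// ltr_wpDl.
  by apply: DeriveDef; [apply/cvg_ex; exists 0|exact: cvg_lim].
Unshelve. all: by end_near. Qed.

Lemma Ck1d_flat k P : Ck1d k (flat P).
Proof.
elim: k P => [|k IH] P /=.
  by move=> x; apply/differentiable_continuous/derivable1_diffP; case: (is_derive_flat P x).
split; first by move=> x; case: (is_derive_flat P x).
rewrite (_ : (flat P)^`()%classic = flat (dflat P)); first exact: IH.
by apply/funext => x; rewrite derive1E; case: (is_derive_flat P x).
Qed.

Definition flat_exp t := flat 1 t.

Lemma flat_expE t : 0 < t -> flat_exp t = expR (- t^-1).
Proof. by move=> t0; rewrite /flat_exp /flat t0 hornerC mul1r. Qed.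

Lemma flat_exp_ge0 t : 0 <= flat_exp t.
Proof. by rewrite /flat_exp /flat; case: ifP => // _; rewrite hornerC mul1r expR_ge0. Qed.

Lemma flat_exp_le1 t : flat_exp t <= 1.
Proof.
rewrite /flat_exp /flat; case: ifP => // t0.
by rewrite hornerC mul1r -expR0 ler_expR oppr_le0 invr_ge0 ltW.
Qed.

Lemma flat_exp_gt0 t : (0 < flat_exp t) = (0 < t).
Proof.
rewrite /flat_exp /flat; case: ifP => //; rewrite ?ltxx//.
by rewrite hornerC mul1r expR_gt0.
Qed.

(** Dilating the variable makes the bumps converge to an indicator function
    while their support stays put. *)
Lemma flat_exp_cvg1 t : 0 < t -> flat_exp (n.+1%:R * t) @[n --> \oo] --> (1 : R).
Proof.
move=> t0.
rewrite (_ : (fun n => _) = (fun n : nat => expR (- (n.+1%:R^-1 * t^-1)))); last first.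
  by apply/funext => n; rewrite flat_expE ?mulr_gt0// invfM.
have h0 : (fun n : nat => - (n.+1%:R^-1 * t^-1)) @ \oo --> (0 : R).
  have := cvgN (cvgM (@cvg_harmonic R) (cvg_cst t^-1)).
  by rewrite mul0r oppr0; exact.
have := continuous_cvg _ (@continuous_expR R 0) h0.
by rewrite expR0; exact.
Qed.

End FlatExp.

Section Bump.
Variable R : realType.
Implicit Types (a b c d : R) (n : nat).

Definition bump n a b c d : R * R -> R := fun x =>
  flat_exp (n.+1%:R * (x.1 - a)) * flat_exp (n.+1%:R * (b - x.1)) *
  (flat_exp (n.+1%:R * (x.2 - c)) * flat_exp (n.+1%:R * (d - x.2))).

Lemma smooth_bump n a b c d : smooth (bump n a b c d).
Proof.
move=> k; have S p q r := @Ck_comp_affine R k (@flat_exp R) p q r (@Ck1d_flat R k 1).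
pose N : R := n.+1%:R.
rewrite (_ : bump n a b c d =
  ((fun x : R * R => flat_exp (N * x.1 + 0 * x.2 + - (N * a))) *
   (fun x : R * R => flat_exp (- N * x.1 + 0 * x.2 + N * b))) *
  ((fun x : R * R => flat_exp (0 * x.1 + N * x.2 + - (N * c))) *
   (fun x : R * R => flat_exp (0 * x.1 + - N * x.2 + N * d)))).
  by apply: CkM; apply: CkM; exact: S.
apply/funext => x; rewrite /bump -/N.
by congr (flat_exp _ * flat_exp _ * (flat_exp _ * flat_exp _)); ring.
Qed.

Lemma bump_ge0 n a b c d x : 0 <= bump n a b c d x.
Proof. by rewrite !mulr_ge0// flat_exp_ge0. Qed.

Lemma bump_le1 n a b c d x : bump n a b c d x <= 1.
Proof. by rewrite !mulr_ile1 ?mulr_ge0 ?flat_exp_ge0 ?flat_exp_le1. Qed.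

Lemma bump_neq0 n a b c d x : (bump n a b c d x != 0) = (x \in box a b c d).
Proof.
have E t : (flat_exp (n.+1%:R * t) != 0 :> R) = (0 < t).
  by rewrite -(pmulr_rgt0 _ (ltr0Sn R n)) -flat_exp_gt0 lt0r flat_exp_ge0 andbT.
rewrite /bump !mulf_eq0 !negb_or !E !subr_gt0.
apply/idP/idP => [/andP[/andP[a1 a2] /andP[a3 a4]]|]; rewrite inE.
  by split; rewrite /= in_itv/=; apply/andP.
by move=> [/=]; rewrite !in_itv/= => -> ->.
Qed.

Lemma closed_cbox a b c d : closed (cbox a b c d).
Proof.
rewrite (_ : cbox a b c d = (fst @^-1` `[a, b]%classic) `&` (snd @^-1` `[c, d]%classic)) //.
apply: closedI; apply: preimage_closed; try exact: interval_closed.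
- by move=> x _; exact: cvg_fst.
- by move=> x _; exact: cvg_snd.
Qed.

Lemma compact_cbox a b c d : compact (cbox a b c d).
Proof. by apply: compact_setX; exact: segment_compact. Qed.

Lemma support_bump n a b c d : support (bump n a b c d) `<=` cbox a b c d.
Proof.
rewrite [X in _ `<=` X]((closure_id _).1 (@closed_cbox a b c d)).
apply: closureS => x /=; rewrite bump_neq0 inE; exact: box_subset_cbox.
Qed.

Lemma test_function_bump (A : set (R * R)) n a b c d : cbox a b c d `<=` A ->
  test_function A (bump n a b c d).
Proof.
move=> bA; split; first exact: smooth_bump.
- apply: subclosed_compact (@compact_cbox a b c d) (@support_bump n a b c d).
  exact: closed_closure.
- exact: subset_trans (@support_bump n a b c d) bA.
Qed.

Lemma bump_cvg a b c d x : box a b c d x ->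
  bump n a b c d x @[n --> \oo] --> (1 : R).
Proof.
move=> [/=]; rewrite !in_itv/= => /andP[h1 h2] /andP[h3 h4].
have H t : 0 < t -> flat_exp (n.+1%:R * t) @[n --> \oo] --> (1 : R) by exact: flat_exp_cvg1.
move: h1 h2 h3 h4; rewrite -subr_gt0 => /H h1; rewrite -subr_gt0 => /H h2.
rewrite -subr_gt0 => /H h3; rewrite -subr_gt0 => /H h4.
by have := cvgM (cvgM h1 h2) (cvgM h3 h4); rewrite !mulr1; exact.
Qed.

End Bump.

(** * Uniqueness of weak derivatives *)

Section DuBoisReymond.
Variable R : realType.
Implicit Types (A : set (plane R)) (g : R * R -> R).

Lemma integrable_L2_box A g (a b c d : R) : measurable A -> in_L2 A g ->
  box a b c d `<=` A -> (@lebesgue2 R).-integrable (box a b c d) (EFin \o g).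
Proof.
move=> mA gA bA; have mb := measurable_box a b c d.
have gb : in_L2 (box a b c d) g.
  split; first by apply: measurable_funS gA.1.
  apply: le_lt_trans gA.2; apply: ge0_subset_integral => //.
  - by apply/measurable_EFinP/measurable_funX; exact: gA.1.
  - by move=> x _; rewrite lee_fin sqr_ge0.
have ob : in_L2 (box a b c d) (cst 1).
  split; first exact: measurable_cst.
  rewrite /sqnorm; under eq_integral do rewrite expr1n.
  by rewrite integral_cst//= mul1e lebesgue2_box_lty.
by have := integrable_mul mb gb ob; congr integrable; apply/funext => x /=; rewrite mulr1.
Qed.

(** The bumps of the box are test functions and converge to its indicator;
    dominated convergence passes to the limit. *)
Lemma integral_box_eq0 A g (a b c d : R) : measurable A -> in_L2 A g ->
  (forall phi, test_function A phi -> \int[@lebesgue2 R]_(x in A) (g x * phi x) = 0) ->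
  cbox a b c d `<=` A ->
  (\int[@lebesgue2 R]_(x in box a b c d) (g x)%:E = 0)%E.
Proof.
move=> mA gA H cbA; have bA := subset_trans (@box_subset_cbox _ a b c d) cbA.
have mb := measurable_box a b c d.
have ig := integrable_L2_box mA gA bA.
have mg := measurable_int _ ig.
have mbump n : measurable_fun (box a b c d : set (plane R)) (bump n a b c d).
  by apply: measurable_funTS; apply: continuous_measurable2; exact: (smooth_bump n a b c d 0%N).
have mgb n : measurable_fun (box a b c d : set (plane R))
    (fun x => (g x * bump n a b c d x)%:E).
  by apply/measurable_EFinP/measurable_funM => //; exact/measurable_EFinP.
have cvg1 : {ae @lebesgue2 R, forall x, box a b c d x ->
    (fun n => (g x * bump n a b c d x)%:E) @ \oo --> (EFin \o g) x}.
  apply: aeW => x bx; apply: cvg_EFin; first exact: nearW.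
  rewrite -[X in _ --> X](mulr1 (g x)).
  by apply: cvgMl_tmp; exact: bump_cvg.
have dom : {ae @lebesgue2 R, forall x n, box a b c d x ->
    (`|(g x * bump n a b c d x)%:E| <= `|g x|%:E)%E}.
  apply: aeW => x n _; rewrite lee_fin normrM ler_piMr//.
  by rewrite ger0_norm ?bump_ge0 ?bump_le1.
have [_ _ lim] := @dominated_convergence _ _ _ (@lebesgue2 R) (box a b c d) mb
  (fun n x => (g x * bump n a b c d x)%:E) (EFin \o g) (fun x => `|g x|%:E)
  mgb mg cvg1 (integrable_norm ig) dom.
have I0 n : (\int[@lebesgue2 R]_(x in box a b c d) (g x * bump n a b c d x)%:E = 0)%E.
  have tb := test_function_bump n cbA.
  have i0 := integrable_mul mA gA (test_function_in_L2 mA tb).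
  have H0 := congr1 EFin (H _ tb); move: H0; rewrite /Rintegral.
  rewrite fineK; last exact: integrable_fin_num i0.
  move=> H0; apply: etrans H0.
  rewrite [LHS]integral_mkcond [RHS]integral_mkcond. apply: eq_integral => x _.
  rewrite !patchE; case: ifPn => bx.
    by rewrite ifT// inE; apply: bA; rewrite -inE.
  case: ifP => // _; have /eqP -> : bump n a b c d x == 0.
    by rewrite -[_ == _]negbK bump_neq0.
  by rewrite mulr0.
have {}lim : (cst 0%E : nat -> \bar R) @ \oo -->
    (\int[@lebesgue2 R]_(x in box a b c d) (g x)%:E)%E.
  by move: lim; rewrite (_ : [sequence _]_n = cst 0%E)//; apply/funext => n; exact: I0.
by rewrite -(cvg_lim (@ereal_hausdorff R) lim) lim_cst//; exact: ereal_hausdorff.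
Qed.

End DuBoisReymond.

Section BoxDynkin.
Variable R : realType.

(** The whole line is adjoined to the open intervals so that the preimages of an
    interval under the two projections are rectangles of the family [rects],
    which therefore generates the Borel sets of the plane. *)
Definition itvT : set (set R) :=
  [set I | (exists x y, I = `]x, y[%classic) \/ I = setT].

Definition rects : set (set (plane R)) := [set I `*` J | I in itvT & J in itvT].

Lemma itvooI (a b x y : R) :
  `]a, b[%classic `&` `]x, y[%classic = `]Num.max a x, Num.min b y[%classic.
Proof.
apply/seteqP; split => t /=; rewrite !in_itv/= gt_max lt_min.
  by move=> [/andP[-> ->] /andP[-> ->]].
by move=> /andP[/andP[-> ->] /andP[-> ->]].
Qed.

Lemma itvTI : setI_closed itvT.
Proof.
move=> I J [[a [b ->]]|->] [[x [y ->]]|->]; rewrite ?setTI ?setIT.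
- by left; rewrite itvooI; eexists; eexists; reflexivity.
- by left; exists a, b.
- by left; exists x, y.
- by right.
Qed.

Lemma measurable_itvT (I : set (measurableTypeR R)) : itvT I -> measurable I.
Proof. by move=> [[x [y ->]]|->]; [exact: measurable_itv|exact: measurableT]. Qed.

Lemma rectsI : setI_closed rects.
Proof.
move=> _ _ [I hI [J hJ <-]] [I' hI' [J' hJ' <-]]; rewrite -setXI.
by exists (I `&` I'); [exact: itvTI|exists (J `&` J') => //; exact: itvTI].
Qed.

Lemma measurable_rects : @measurable _ (plane R) = <<s rects >>.
Proof.
apply/seteqP; split; last first.
  apply: smallest_sub; first exact: sigma_algebra_measurable.
  by move=> _ [I hI [J hJ <-]]; apply: measurableX; exact: measurable_itvT.
rewrite measurable_prod_measurableType.
apply: smallest_sub; first exact: smallest_sigma_algebra.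
have mfst : measurable_fun setT (fst : g_sigma_algebraType rects -> measurableTypeR R).
  apply: (measurability _ (RGenOpens.measurableE R)).
  move=> _ [_ [x [y ->]] <-]; rewrite setTI; apply: sub_sigma_algebra.
  exists `]x, y[%classic; first by left; exists x, y.
  exists setT; first by right.
  by apply/seteqP; split => t //= [].
have msnd : measurable_fun setT (snd : g_sigma_algebraType rects -> measurableTypeR R).
  apply: (measurability _ (RGenOpens.measurableE R)).
  move=> _ [_ [x [y ->]] <-]; rewrite setTI; apply: sub_sigma_algebra.
  exists setT; first by right.
  exists `]x, y[%classic; first by left; exists x, y.
  by apply/seteqP; split => t //= [].
move=> _ [A mA [B mB <-]].
have := measurableI _ _ (mfst measurableT A mA) (msnd measurableT B mB).
by rewrite !setTI; congr measurable.
Qed.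

Lemma boxI_rects (a b c d : R) (S : set (plane R)) : rects S ->
  exists p q r s, box a b c d `&` S = box p q r s /\ cbox p q r s `<=` cbox a b c d.
Proof.
have H x y I : itvT I -> exists p q, `]x, y[%classic `&` I = `]p, q[%classic /\
    `[p, q]%classic `<=` `[x, y]%classic.
  move=> [[u [v ->]]|->]; last by exists x, y; split => //; rewrite setIT.
  exists (Num.max x u), (Num.min y v); split; first exact: itvooI.
  move=> t /=; rewrite !in_itv/= ge_max le_min.
  by move=> /andP[/andP[-> _] /andP[-> _]].
move=> [I hI [J hJ <-]].
have [p [q [e1 s1]]] := H a b I hI; have [r [s [e2 s2]]] := H c d J hJ.
exists p, q, r, s; split; first by rewrite /box -setXI e1 e2.
by move=> x [/= /s1 h1 /s2 h2].
Qed.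

(** The sets on which [g] integrates to zero inside the box form a Dynkin class,
    and the rectangles, which meet the box in a smaller box, form a
    pi-system. *)
Lemma integral_boxI_eq0 (g : R * R -> R) (a b c d : R) :
  (@lebesgue2 R).-integrable (box a b c d) (EFin \o g) ->
  (forall p q r s, cbox p q r s `<=` cbox a b c d ->
    (\int[@lebesgue2 R]_(x in box p q r s) (g x)%:E = 0)%E) ->
  forall E : set (plane R), measurable E ->
    (\int[@lebesgue2 R]_(x in box a b c d `&` E) (g x)%:E = 0)%E.
Proof.
move=> ig H E mE.
have mb := measurable_box a b c d.
have iS (S : set (plane R)) : measurable S ->
    (@lebesgue2 R).-integrable (box a b c d `&` S) (EFin \o g).
  by move=> mS; apply: integrableS ig => //; exact: measurableI.
have I0 : (\int[@lebesgue2 R]_(x in box a b c d) (g x)%:E = 0)%E by exact: H.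
apply: (@dynkin_induction _ (plane R) rects (fun E =>
  (\int[@lebesgue2 R]_(x in box a b c d `&` E) (g x)%:E = 0)%E)).
- exact: measurable_rects.
- exact: rectsI.
- by rewrite setIT.
- move=> S /(boxI_rects a b c d)[p [q [r [s [-> sub]]]]]; exact: H.
- move=> S mS S0; rewrite -[LHS]add0e -{1}S0 -integral_setU//.
  + by rewrite -setIUr setUv setIT.
  + exact: measurableI.
  + by apply: measurableI => //; exact: measurableC.
  + by rewrite -setIUr setUv setIT; exact: measurable_int ig.
  + by rewrite disj_set2E setIACA setICr setI0.
- move=> F mF tF F0.
  rewrite setI_bigcupr integral_bigcup.
  + by apply: eseries0 => k _ _; exact: F0.
  + exact: trivIset_setIl.
  + by move=> k; apply: measurableI.
  + by rewrite -setI_bigcupr; apply: iS; exact: bigcupT_measurable.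
- by rewrite -measurable_rects.
Qed.

(** Inside a box with closure in [A] all integrals of [g] over Borel sets
    vanish, so [g] vanishes there almost everywhere; countably many such boxes
    cover [A]. *)
Lemma du_bois_reymond (A : set (R * R)) (g : R * R -> R) : open A -> in_L2 A g ->
  (forall phi, test_function A phi -> \int[@lebesgue2 R]_(x in A) (g x * phi x) = 0) ->
  ae_zero A g.
Proof.
move=> oA gA H; have mA := open_measurable2 oA.
have null n : ae_zero (inner_box A n) g.
  rewrite /inner_box; case: (unpickle n) => [[[[p q] r] s]|]; last by apply: aeW.
  case: asboolP => sA; last by apply: aeW.
  set a := ratr p; set b := ratr q; set c := ratr r; set d := ratr s.
  have mb := measurable_box a b c d.
  have ig : (@lebesgue2 R).-integrable (box a b c d) (EFin \o g).
    by apply: integrable_L2_box mA gA _; exact: subset_trans (@box_subset_cbox _ _ _ _ _) sA.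
  have I0 := integral_boxI_eq0 ig (fun p' q' r' s' sub =>
     integral_box_eq0 mA gA H (subset_trans sub sA)).
  have : ae_eq (@lebesgue2 R) (box a b c d) (EFin \o g) (cst 0%E).
    apply: (integral_ae_eq mb ig); first exact: measurable_cst.
    move=> E Eb mE; rewrite integral0.
    by rewrite -(setIidr Eb); exact: I0.
  by apply: ae_imply => x /= + bx => /(_ bx) [].
have cov x : A x -> exists n, inner_box A n x.
  by rewrite {1}(open_bigcup_inner_box oA) => -[n _ nx]; exists n.
have : (@lebesgue2 R).-negligible
    (\bigcup_n ~` [set x | inner_box A n x -> g x = 0]).
  by apply: negligible_bigcup => n; exact: null.
apply: negligibleS.
move=> x /= /not_implyP[/cov[n nx] gx]; exists n; first exact: Logic.I.
by move=> /(_ nx).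
Qed.

End BoxDynkin.

(** * Sobolev functions and their gradients *)

Section WeakPartial.
Variables (R : realType) (A : set (R * R)).
Hypothesis oA : open A.
Implicit Types (u g : R * R -> R) (v : R * R).

Let mA : measurable (A : set (plane R)) := open_measurable2 oA.

Lemma weak_partialP v u g : is_weak_partial A v u g ->
  is_weak_partial A v u (weak_partial A v u).
Proof. by move=> ug; apply: (xgetPex (cst 0)); exists g. Qed.

Lemma is_weak_partial_unique v u g h :
  is_weak_partial A v u g -> is_weak_partial A v u h -> ae_zero A (g \- h).
Proof.
move=> [g2 ug] [h2 uh]; apply: du_bois_reymond => //; first exact: in_L2B.
move=> phi tphi; have p2 := test_function_in_L2 mA tphi.
have := ug _ tphi; rewrite uh// => /oppr_inj e.
rewrite (_ : (fun x => _) = (fun x => g x * phi x - h x * phi x)); last first.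
  by apply/funext => x /=; rewrite mulrBl.
by rewrite RintegralB ?e ?subrr//; exact: integrable_mul.
Qed.

(** The chosen representative of the weak derivative can be replaced by any
    weak derivative at hand: this is how [grad_sqnorm] gets computed. *)
Lemma sqnorm_weak_partial v u g : is_weak_partial A v u g ->
  sqnorm A (weak_partial A v u) = sqnorm A g.
Proof.
move=> ug; have uw := weak_partialP ug.
apply: sqnorm_ae_eq => //; [exact: uw.1.1|exact: ug.1.1|].
exact: is_weak_partial_unique uw ug.
Qed.

Lemma is_weak_partialD v u u' g g' : axis v -> in_L2 A u -> in_L2 A u' ->
  is_weak_partial A v u g -> is_weak_partial A v u' g' ->
  is_weak_partial A v (fun x => u x + u' x) (fun x => g x + g' x).
Proof.
move=> vA u2 u2' [g2 ug] [g2' ug']; split; first exact: in_L2D.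
move=> phi tphi; have p2 := test_function_in_L2 mA tphi.
have d2 := test_function_in_L2 mA (test_function_derive vA tphi).
under eq_Rintegral do rewrite mulrDl.
under [in RHS]eq_Rintegral do rewrite mulrDl.
by rewrite !RintegralD ?ug ?ug' ?opprD//; exact: integrable_mul.
Qed.

Lemma is_weak_partialZ v k u g : axis v -> in_L2 A u ->
  is_weak_partial A v u g ->
  is_weak_partial A v (fun x => k * u x) (fun x => k * g x).
Proof.
move=> vA u2 [g2 ug]; split; first exact: in_L2Z.
move=> phi tphi; have p2 := test_function_in_L2 mA tphi.
have d2 := test_function_in_L2 mA (test_function_derive vA tphi).
under eq_Rintegral do rewrite -mulrA.
under [in RHS]eq_Rintegral do rewrite -mulrA.
by rewrite !RintegralZl ?ug ?mulrN//; exact: integrable_mul.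
Qed.

Lemma is_weak_partial_smooth v (B : set (R * R)) phi : axis v ->
  test_function B phi -> is_weak_partial A v phi ('D_v phi).
Proof.
move=> vA tphi; split.
  exact: test_function_in_L2 mA (test_function_derive vA tphi).
by move=> chi tchi; apply: Rintegral_by_parts => //; case: tphi.
Qed.

Lemma is_weak_partial0 v : is_weak_partial A v (cst 0) (cst 0).
Proof.
split; first exact: in_L2_cst0.
move=> phi _; rewrite /Rintegral !integral0_eq ?oppr0// => x _; by rewrite mul0r.
Qed.

Lemma axis1 : axis (e1 R). Proof. by left. Qed.
Lemma axis2 : axis (e2 R). Proof. by right. Qed.

Lemma in_H1D u u' : in_H1 A u -> in_H1 A u' -> in_H1 A (fun x => u x + u' x).
Proof.
move=> [u2 [p up] [q uq]] [u2' [p' up'] [q' uq']]; split.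
- exact: in_L2D.
- by exists (fun x => p x + p' x); apply: is_weak_partialD; first exact: axis1.
- by exists (fun x => q x + q' x); apply: is_weak_partialD; first exact: axis2.
Qed.

Lemma in_H1Z k u : in_H1 A u -> in_H1 A (fun x => k * u x).
Proof.
move=> [u2 [p up] [q uq]]; split.
- exact: in_L2Z.
- by exists (fun x => k * p x); apply: is_weak_partialZ; first exact: axis1.
- by exists (fun x => k * q x); apply: is_weak_partialZ; first exact: axis2.
Qed.

Lemma in_H1_cst0 : in_H1 A (cst 0).
Proof.
split; first exact: in_L2_cst0.
- by exists (cst 0); exact: is_weak_partial0.
- by exists (cst 0); exact: is_weak_partial0.
Qed.

Lemma in_H1_lin_comb j (c : 'I_j -> R) (psi : 'I_j -> R * R -> R) :
  (forall i, in_H1 A (psi i)) -> in_H1 A (lin_comb c psi).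
Proof.
move=> h; rewrite /lin_comb.
rewrite (_ : (fun x => _) = \sum_(i < j) (fun x => c i * psi i x)); last first.
  by apply/funext => x; rewrite fct_sumE.
apply: (big_ind (in_H1 A)).
- exact: in_H1_cst0.
- by move=> u w; exact: in_H1D.
- by move=> i _; exact: in_H1Z.
Qed.

Lemma in_H1_test (B : set (R * R)) phi : test_function B phi -> in_H1 A phi.
Proof.
move=> tphi; split; first exact: test_function_in_L2 tphi.
- by exists ('D_(e1 R) phi); apply: is_weak_partial_smooth tphi; exact: axis1.
- by exists ('D_(e2 R) phi); apply: is_weak_partial_smooth tphi; exact: axis2.
Qed.

Lemma grad_sqnormE u p q : is_weak_partial A (e1 R) u p ->
  is_weak_partial A (e2 R) u q -> grad_sqnorm A u = (sqnorm A p + sqnorm A q)%E.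
Proof.
by move=> up uq; congr (_ + _)%E; [exact: sqnorm_weak_partial up|exact: sqnorm_weak_partial uq].
Qed.

Lemma grad_sqnorm_ge0 u : (0 <= grad_sqnorm A u)%E.
Proof. by apply: adde_ge0; exact: sqnorm_ge0. Qed.

Lemma grad_sqnorm_fin u : in_H1 A u -> grad_sqnorm A u \is a fin_num.
Proof.
move=> [u2 [p up] [q uq]]; rewrite (grad_sqnormE up uq) fin_numD.
by rewrite (sqnorm_fin up.1) (sqnorm_fin uq.1).
Qed.

End WeakPartial.

Lemma sqnormD (R : realType) (A : set (plane R)) (f g : R * R -> R) :
  measurable A -> measurable_fun A f -> measurable_fun A g ->
  (sqnorm A f + sqnorm A g =
   \int[@lebesgue2 R]_(x in A) (f x ^+ 2 + g x ^+ 2)%:E)%E.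
Proof.
move=> mA mf mg; rewrite /sqnorm -ge0_integralD//.
- by move=> x _; rewrite lee_fin sqr_ge0.
- exact/measurable_EFinP/measurable_funX.
- by move=> x _; rewrite lee_fin sqr_ge0.
- exact/measurable_EFinP/measurable_funX.
Qed.

(** * Sobolev functions under triangular maps *)

Section ShearH1.
Variables (R : realType) (a b c : R).
Hypotheses (a0 : 0 < a) (c0 : 0 < c).
Variable A : set (R * R).
Hypothesis oA : open A.
Notation T := (shear a b c).
Notation S := (shear_inv a b c).

Let mA : measurable (A : set (plane R)) := open_measurable2 oA.

Lemma open_preimage_shear : open (T @^-1` A).
Proof. by apply: open_comp => // x _; exact: continuous_shear. Qed.

Lemma support_comp_shear (a' b' c' : R) (f : R * R -> R) :
  support (f \o shear a' b' c') `<=` shear a' b' c' @^-1` support f.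
Proof.
have cl : closed (shear a' b' c' @^-1` support f).
  apply: preimage_closed; last exact: closed_closure.
  by move=> x _; exact: continuous_shear.
rewrite [X in _ `<=` X]((closure_id _).1 cl).
by apply: closureS => x /= fx; exact: support_in fx.
Qed.

Lemma test_function_comp_shear (B : set (R * R)) (f : R * R -> R) :
  test_function B f -> test_function (T @^-1` B) (f \o T).
Proof.
move=> [sf cf fB]; split.
- by move=> k; apply: Ck_comp_shear; exact: sf.
- apply: (@subclosed_compact _ _ (S @` support f)).
  + exact: closed_closure.
  + by apply: continuous_compact cf; apply: continuous_subspaceT; exact: continuous_shear.
  + move=> x /support_comp_shear/= fx; exists (T x) => //.
    by rewrite shearK// gt_eqF.
- by apply: subset_trans (@support_comp_shear a b c f) _ => x /fB.
Qed.

Lemma test_function_shear_inv (f : R * R -> R) : test_function (T @^-1` A) f ->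
  exists2 chi, test_function A chi & f = chi \o T.
Proof.
move=> tf; exists (f \o S); last first.
  by apply/funext => x /=; rewrite shearK// gt_eqF.
case: tf => sf cf fA; split.
- by move=> k; apply: Ck_comp_shear; exact: sf.
- apply: (@subclosed_compact _ _ (T @` support f)).
  + exact: closed_closure.
  + by apply: continuous_compact cf; apply: continuous_subspaceT; exact: continuous_shear.
  + move=> x /support_comp_shear/= fx; exists (S x) => //.
    by rewrite shear_invK// gt_eqF.
- apply: subset_trans (@support_comp_shear _ _ _ f) _ => x /fA /=.
  by rewrite shear_invK// gt_eqF.
Qed.

(** Test functions on the preimage of [A] are the [chi o T] with [chi] a test
    function on [A].  Their derivatives are given by the classical chain rule,
    and the change of variables brings the identity back to [A]. *)
Lemma is_weak_partial_shear u p q : in_L2 A u ->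
  is_weak_partial A (e1 R) u p -> is_weak_partial A (e2 R) u q ->
  is_weak_partial (T @^-1` A) (e1 R) (u \o T) (fun x => a * p (T x)) /\
  is_weak_partial (T @^-1` A) (e2 R) (u \o T) (fun x => b * p (T x) + c * q (T x)).
Proof.
move=> u2 [p2 up] [q2 uq].
have mA' := measurable_preimage_shear a b c mA.
have pT := in_L2_shear b a0 c0 mA p2; have qT := in_L2_shear b a0 c0 mA q2.
split; split; [exact: in_L2Z| |by apply: in_L2D => //; exact: in_L2Z|].
- move=> _ /test_function_shear_inv[chi tchi ->].
  have [schi _ _] := tchi; have [_ [D1 D2]] := derive_shear a b c (schi 1%N).
  have c2 := test_function_in_L2 mA tchi.
  have d1 := test_function_in_L2 mA (test_function_derive (axis1 R) tchi).
  have [_ aup] := is_weak_partialZ oA a (axis1 R) u2 (conj p2 up).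
  have I := Rintegral_shear_in b a0 c0 mA (integrable_mul mA (in_L2Z mA a u2) d1).
  have J := Rintegral_shear_in b a0 c0 mA (integrable_mul mA (in_L2Z mA a p2) c2).
  transitivity ((a * c)^-1 * \int[@lebesgue2 R]_(y in A) (a * u y * 'D_(e1 R) chi y)).
    apply: etrans I; apply: eq_Rintegral => x _.
    by rewrite (congr1 (@^~ x) D1)/= mulrCA mulrA.
  by rewrite aup// mulrN; congr (- _); exact: esym J.
- move=> _ /test_function_shear_inv[chi tchi ->].
  have [schi _ _] := tchi; have [_ [D1 D2]] := derive_shear a b c (schi 1%N).
  have c2 := test_function_in_L2 mA tchi.
  have d1 := test_function_in_L2 mA (test_function_derive (axis1 R) tchi).
  have d2 := test_function_in_L2 mA (test_function_derive (axis2 R) tchi).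
  have [_ bup] := is_weak_partialZ oA b (axis1 R) u2 (conj p2 up).
  have [_ cuq] := is_weak_partialZ oA c (axis2 R) u2 (conj q2 uq).
  have i1 := integrable_mul mA (in_L2Z mA b u2) d1.
  have i2 := integrable_mul mA (in_L2Z mA c u2) d2.
  have j1 := integrable_mul mA (in_L2Z mA b p2) c2.
  have j2 := integrable_mul mA (in_L2Z mA c q2) c2.
  have I := Rintegral_shear_in b a0 c0 mA (integrableD mA i1 i2).
  have J := Rintegral_shear_in b a0 c0 mA (integrableD mA j1 j2).
  transitivity ((a * c)^-1 * \int[@lebesgue2 R]_(y in A)
      (b * u y * 'D_(e1 R) chi y + c * u y * 'D_(e2 R) chi y)).
    apply: etrans I; apply: eq_Rintegral => x _.
    by rewrite (congr1 (@^~ x) D2)/=; ring.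
  rewrite RintegralD// (bup _ tchi) (cuq _ tchi) -opprD mulrN; congr (- _).
  rewrite -RintegralD//; apply: esym; apply: etrans J.
  by apply: eq_Rintegral => x _ /=; rewrite mulrDl.
Qed.

(** The transpose of [T] does not increase lengths: it acts on gradients. *)
Hypothesis contracting : forall s t : R,
  (a * s) ^+ 2 + (b * s + c * t) ^+ 2 <= s ^+ 2 + t ^+ 2.

Lemma in_H1_shear u : in_H1 A u -> in_H1 (T @^-1` A) (u \o T).
Proof.
move=> [u2 [p up] [q uq]]; have [pT qT] := is_weak_partial_shear u2 up uq.
split; [exact: in_L2_shear|by eexists; exact: pT|by eexists; exact: qT].
Qed.

Lemma grad_sqnorm_shear_le u : in_H1 A u ->
  (grad_sqnorm (T @^-1` A) (u \o T) <= (a * c)^-1%:E * grad_sqnorm A u)%E.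
Proof.
move=> [u2 [p up] [q uq]]; have [pT qT] := is_weak_partial_shear u2 up uq.
have oT := open_preimage_shear.
rewrite (grad_sqnormE oT pT qT) (grad_sqnormE oA up uq).
rewrite ge0_muleDr ?sqnorm_ge0//.
have mp := up.1.1; have mq := uq.1.1.
have mA' := measurable_preimage_shear a b c mA.
have mpT : measurable_fun (T @^-1` A : set (plane R)) (p \o T).
  exact: measurable_fun_shear.
have mqT : measurable_fun (T @^-1` A : set (plane R)) (q \o T).
  exact: measurable_fun_shear.
rewrite -(sqnorm_shear b a0 c0 mA mp) -(sqnorm_shear b a0 c0 mA mq).
rewrite (sqnormD mA' pT.1.1 qT.1.1) (sqnormD mA' mpT mqT).
apply: ge0_le_integral => //.
- by move=> x _; rewrite lee_fin addr_ge0// sqr_ge0.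
- apply/measurable_EFinP; apply: measurable_funD; apply: measurable_funX.
    exact: pT.1.1.
  exact: qT.1.1.
- by apply/measurable_EFinP; apply: measurable_funD; apply: measurable_funX.
- by move=> x _; rewrite lee_fin; exact: contracting.
Qed.

Lemma H1_sqnorm_shear_le u : in_H1 A u ->
  (H1_sqnorm (T @^-1` A) (u \o T) <= (a * c)^-1%:E * H1_sqnorm A u)%E.
Proof.
move=> u1; have [[mu _] _ _] := u1.
rewrite /H1_sqnorm ge0_muleDr ?sqnorm_ge0 ?grad_sqnorm_ge0//.
by rewrite (sqnorm_shear b a0 c0 mA mu) leeD2l// grad_sqnorm_shear_le.
Qed.

Lemma ae_zero_shear u : measurable_fun (A : set (plane R)) u ->
  ae_zero (T @^-1` A) (u \o T) <-> ae_zero A u.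
Proof.
move=> mu; have mA' := measurable_preimage_shear a b c mA.
have muT : measurable_fun (T @^-1` A : set (plane R)) (u \o T).
  exact: measurable_fun_shear.
rewrite -(sqnorm_eq0 mA mu) -(sqnorm_eq0 mA' muT) (sqnorm_shear b a0 c0 mA mu).
split=> [/eqP|->]; last by rewrite mule0.
by rewrite mule_eq0 eqe invr_eq0 mulf_eq0 (gt_eqF a0) (gt_eqF c0)/= => /eqP.
Qed.

End ShearH1.

(** * The half-guide and its Dirichlet boundary *)

Section Geometry.
Variables (R : realType) (theta : R).
Hypothesis theta_in : 0 < theta < pi / 2.

Lemma sin_acute_gt0 : 0 < sin theta.
Proof.
case/andP: theta_in => t0 t1; apply: sin_gt0_pi; apply/andP; split => //.
by have := pi_gt0 R; lra.
Qed.

Lemma cos_acute_gt0 : 0 < cos theta.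
Proof. by case/andP: theta_in => t0 t1; apply: cos_gt0_pihalf; apply/andP; split; lra. Qed.

Let s0 := sin_acute_gt0.
Let c0 := cos_acute_gt0.

(** Multiplying by [sin theta] and [cos theta], which are positive, makes all
    the inequalities linear. *)
Lemma half_guideP (x : R * R) : half_guide theta x <->
  [/\ 0 < x.2, x.1 * sin theta < x.2 * cos theta &
      x.2 * cos theta < x.1 * sin theta + pi].
Proof.
have E (y z : R) : (y * tan theta < z) = (y * sin theta < z * cos theta).
  by rewrite /tan mulrA ltr_pdivrMr.
have E' (y z : R) : (z < y * tan theta) = (z * cos theta < y * sin theta).
  by rewrite /tan mulrA ltr_pdivlMr.
rewrite /half_guide /guide /= E E' mulrDl divfK ?gt_eqF//.
split=> [[[h1 h2] h3]|[h1 h2 h3]].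
  by rewrite ger0_norm ?ltW// in h1 h2 *.
by rewrite ger0_norm ?ltW.
Qed.

Lemma open_half_guide : open (half_guide theta).
Proof.
have op p q r : open [set x : R * R | 0 < p * x.1 + q * x.2 + r].
  have cf := @continuous_affine R p q r.
  exact: ((@continuousP _ _ (fun x : R * R => p * x.1 + q * x.2 + r)).1 cf
    [set y : R | 0 < y] (@open_gt R 0)).
rewrite (_ : half_guide theta =
    [set x : R * R | 0 < 0 * x.1 + 1 * x.2 + 0] `&`
    ([set x : R * R | 0 < - sin theta * x.1 + cos theta * x.2 + 0] `&`
    [set x : R * R | 0 < sin theta * x.1 + - cos theta * x.2 + pi])).
  by apply: openI; [exact: op|apply: openI; exact: op].
apply/seteqP; split => x /=.
  by move/half_guideP => [h1 h2 h3]; split; [|split]; lra.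
by move=> [h1 [h2 h3]]; apply/half_guideP; split; lra.
Qed.

Lemma dir_boundary_out x : dir_boundary theta x -> ~ half_guide theta x.
Proof.
move=> [_ [_ nint]] hx; apply: nint.
by rewrite (interior_id _).1//; exact: open_half_guide.
Qed.

(** A point satisfying the large inequalities is the limit of the points of the
    segment joining it to a point of the convex open half-guide. *)
Lemma closure_half_guide (x : R * R) : 0 <= x.2 ->
  x.1 * sin theta <= x.2 * cos theta <= x.1 * sin theta + pi ->
  closure (half_guide theta) x.
Proof.
move=> x2 /andP[xl xr] B nB.
(* a point half-way between the two boundary lines, at unit distance from the
   middle of the horizontal edge *)
pose q : R * R := (cos theta - pi / 2 / sin theta, sin theta).
have q2 : 0 < q.2 by [].
have qE : q.2 * cos theta - q.1 * sin theta = pi / 2.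
  by rewrite /q /=; field; rewrite gt_eqF.
have cv : (fun e : R => e *: (q - x) + x) @ (0 : R) --> x.
  have : (fun e : R => e *: (q - x) + x) @ (0 : R) --> 0 *: (q - x) + x.
    by apply: cvgD; [apply: cvgZr_tmp; exact: cvg_id|exact: cvg_cst].
  by rewrite scale0r add0r.
have /cvg_at_right_filter cv' := cv.
have pi0 := pi_gt0 R.
suff [e [He Be]] : exists e : R, 0 < e < 1 /\ B (e *: (q - x) + x).
  exists (e *: (q - x) + x); split => //; apply/half_guideP.
  case/andP: He => e0 e1.
  have E1 : (e *: (q - x) + x).1 = e * (q.1 - x.1) + x.1 by [].
  have E2 : (e *: (q - x) + x).2 = e * (q.2 - x.2) + x.2 by [].
  rewrite E1 E2; split.
  - by have := mulr_gt0 e0 q2; nra.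
  - by nra.
  - by nra.
have ev : \forall e \near (0 : R)^'+, 0 < e < 1 /\ B (e *: (q - x) + x).
  near=> e; split; last by near: e; exact: (cv' _ nB).
  by apply/andP; split; near: e; [exact: nbhs_right_gt|exact: nbhs_right_lt].
exact: filter_ex ev.
Unshelve. all: by end_near. Qed.

(** Both components of the Dirichlet boundary are the same half-line in the
    parametrization by arc length, whatever the angle: transporting a boundary
    norm from one angle to another is a dilation of the parameter. *)
Lemma line_dir_boundary (alpha : R) : alpha = 0 \/ alpha = - (pi / sin theta) ->
  line theta alpha @^-1` dir_boundary theta = `[0, +oo[%classic.
Proof.
move=> aE.
have as0 : alpha * sin theta = 0 \/ alpha * sin theta = - pi.
  by case: aE => ->; [left; rewrite mul0r|right; rewrite mulNr divfK ?gt_eqF].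
apply/seteqP; split => t /=; rewrite in_itv/= andbT.
  move=> [_ [cl _]]; rewrite leNgt; apply/negP => t0.
  have clo : closed [set x : R * R | 0 <= x.2].
    apply: (@preimage_closed _ _ snd [set y : R | 0 <= y]).
      by move=> x _; exact: cvg_snd.
    exact: closed_ge.
  have sub : half_guide theta `<=` [set x : R * R | 0 <= x.2].
    by move=> x [_ /ltW].
  have := closureS sub cl; rewrite -(closure_id _).1//= leNgt.
  by rewrite pmulr_llt0 ?t0.
move=> t0; set x := line theta alpha t.
have x2 : 0 <= x.2 by rewrite /x/= mulr_ge0// ltW.
have clx : closure (half_guide theta) x.
  apply: closure_half_guide => //; rewrite /x/= mulrDl.
  by have := pi_gt0 R; case: as0 => ->; rewrite mulrAC => pi0; apply/andP; split; lra.
have nguide : ~ guide theta x.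
  move=> []; rewrite ger0_norm//; rewrite /x /line /=.
  have E : t * cos theta * tan theta = t * sin theta.
    by rewrite /tan; field; rewrite gt_eqF.
  case: aE => ->; first by rewrite add0r E ltxx.
  by rewrite addrAC addNr add0r E ltxx.
split; split.
- by apply: closureS clx => y [].
- by move=> /interior_subset.
- exact: clx.
- by move=> /interior_subset[].
Qed.

End Geometry.

(** * The map between two half-guides *)

Section GuideMap.
Variables (R : realType) (th1 th2 : R).
Hypotheses (th1_in : 0 < th1 < pi / 2) (th2_in : 0 < th2 < pi / 2).

Let s1 : 0 < sin th1 := sin_acute_gt0 th1_in.
Let s2 : 0 < sin th2 := sin_acute_gt0 th2_in.
Let c1 : 0 < cos th1 := cos_acute_gt0 th1_in.
Let c2 : 0 < cos th2 := cos_acute_gt0 th2_in.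

(** These coefficients are forced by two requirements: the horizontal edge, of
    length [pi / sin th1], goes onto the one of length [pi / sin th2], and the
    direction [(cos th1, sin th1)] of the guide goes to [guide_k] times
    [(cos th2, sin th2)]. *)
Definition guide_a : R := sin th1 / sin th2.
Definition guide_b : R := (cos th2 ^+ 2 - cos th1 ^+ 2) / (cos th1 * sin th2).
Definition guide_c : R := cos th2 / cos th1.
Definition guide_k : R := tan th1 / tan th2.
Definition guide_map : R * R -> R * R := shear guide_a guide_b guide_c.

Lemma guide_a_gt0 : 0 < guide_a. Proof. exact: divr_gt0. Qed.
Lemma guide_c_gt0 : 0 < guide_c. Proof. exact: divr_gt0. Qed.
Lemma guide_k_gt0 : 0 < guide_k. Proof. by rewrite !divr_gt0. Qed.

Let n1 : sin th1 != 0. Proof. by rewrite gt_eqF. Qed.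
Let n2 : sin th2 != 0. Proof. by rewrite gt_eqF. Qed.
Let m1 : cos th1 != 0. Proof. by rewrite gt_eqF. Qed.
Let m2 : cos th2 != 0. Proof. by rewrite gt_eqF. Qed.

(** The map moves points along the guide only: the signed distance to the
    boundary line through the origin is preserved. *)
Lemma guide_map_normal x :
  (guide_map x).1 * sin th2 - (guide_map x).2 * cos th2 =
  x.1 * sin th1 - x.2 * cos th1.
Proof.
rewrite /guide_map /shear /= /guide_a /guide_b /guide_c.
by field; rewrite n2 m1.
Qed.

Lemma preimage_half_guide : half_guide th1 = guide_map @^-1` half_guide th2.
Proof.
have pos x : (0 < (guide_map x).2) = (0 < x.2) by rewrite /= pmulr_rgt0// guide_c_gt0.
apply/seteqP; split => x /=.
  move/(half_guideP th1_in) => [h1 h2 h3]; apply/(half_guideP th2_in).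
  by have N := guide_map_normal x; split; [rewrite pos|lra|lra].
move/(half_guideP th2_in) => [h1 h2 h3]; apply/(half_guideP th1_in).
by have N := guide_map_normal x; split; [rewrite -pos|lra|lra].
Qed.

Lemma guide_map_line0 t : guide_map (line th1 0 t) = line th2 0 (guide_k * t).
Proof.
by congr pair; rewrite /= /guide_a /guide_b /guide_c /guide_k /tan;
  field; rewrite ?n2 ?m1 ?m2.
Qed.

Lemma guide_map_line1 t : guide_map (line th1 (- (pi / sin th1)) t) =
  line th2 (- (pi / sin th2)) (guide_k * t).
Proof.
by congr pair; rewrite /= /guide_a /guide_b /guide_c /guide_k /tan;
  field; rewrite ?n1 ?n2 ?m1 ?m2.
Qed.

(** The singular values of the map are [guide_k], along the guide, and [1],
    across it. *)
Lemma guide_map_contracting (s t : R) : th1 <= th2 ->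
  (guide_a * s) ^+ 2 + (guide_b * s + guide_c * t) ^+ 2 <= s ^+ 2 + t ^+ 2.
Proof.
move=> le12.
have E1 : sin th1 ^+ 2 = 1 - cos th1 ^+ 2 by rewrite -(cos2Dsin2 th1); ring.
have E2 : sin th2 ^+ 2 = 1 - cos th2 ^+ 2 by rewrite -(cos2Dsin2 th2); ring.
rewrite -subr_ge0.
set S1 := sin th1 in E1; set S2 := sin th2 in E2.
set C1 := cos th1 in E1 E2; set C2 := cos th2 in E2.
(* the loss of length is that of the longitudinal component, shrunk by guide_k *)
have -> : s ^+ 2 + t ^+ 2 - ((guide_a * s) ^+ 2 + (guide_b * s + guide_c * t) ^+ 2) =
   (1 - guide_k ^+ 2) * (s * C2 + t * S2) ^+ 2.
  (* denominators are cleared and the squares of sines isolated, so that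
     cos^2 + sin^2 = 1 can be substituted *)
  have key : C1 ^+ 2 * S2 ^+ 2 * (s ^+ 2 + t ^+ 2) - (S1 ^+ 2 * C1 ^+ 2 * s ^+ 2 +
       ((C2 ^+ 2 - C1 ^+ 2) ^+ 2 * s ^+ 2 + 2 * (C2 ^+ 2 - C1 ^+ 2) * C2 * S2 * s * t +
         C2 ^+ 2 * S2 ^+ 2 * t ^+ 2)) =
     (C1 ^+ 2 * S2 ^+ 2 - S1 ^+ 2 * C2 ^+ 2) *
       (s ^+ 2 * C2 ^+ 2 + 2 * s * t * C2 * S2 + t ^+ 2 * S2 ^+ 2).
    by rewrite E1 E2; ring.
  rewrite /guide_a /guide_b /guide_c /guide_k /tan -/S1 -/S2 -/C1 -/C2.
  apply: (mulfI (_ : C1 ^+ 2 * S2 ^+ 2 != 0)).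
    by rewrite mulf_neq0// expf_neq0.
  transitivity (C1 ^+ 2 * S2 ^+ 2 * (s ^+ 2 + t ^+ 2) - (S1 ^+ 2 * C1 ^+ 2 * s ^+ 2 +
       ((C2 ^+ 2 - C1 ^+ 2) ^+ 2 * s ^+ 2 + 2 * (C2 ^+ 2 - C1 ^+ 2) * C2 * S2 * s * t +
         C2 ^+ 2 * S2 ^+ 2 * t ^+ 2))).
    by field; rewrite n2 m1.
  by rewrite key; field; rewrite n2 m1 m2.
rewrite mulr_ge0 ?sqr_ge0// subr_ge0 expr_le1 ?(ltW guide_k_gt0)//.
rewrite /guide_k ler_pdivrMr ?mul1r; last by rewrite divr_gt0.
move: le12; rewrite le_eqVlt => /predU1P[->//|lt12]; apply: ltW.
by rewrite ltr_tan// in_itv/=; apply/andP; case/andP: th1_in; case/andP: th2_in; split; lra.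
Qed.

End GuideMap.

(** * Monotonicity of the min-max values *)

Lemma ler_scaled_quotient (R : realFieldType) (r g s g' : R) :
  0 < r -> 0 < s -> g' <= r * g -> g' / (r * s) <= g / s.
Proof.
move=> r0 s0 h; rewrite ler_pdivrMr ?mulr_gt0//.
by rewrite (_ : g / s * (r * s) = r * g)//; field; rewrite gt_eqF.
Qed.

Section Monotonicity.
Variables (R : realType) (th1 th2 : R).
Hypotheses (th1_in : 0 < th1 < pi / 2) (th2_in : 0 < th2 < pi / 2).
Hypothesis th12 : th1 <= th2.

Notation T := (guide_map th1 th2).
Notation a := (guide_a th1 th2).
Notation b := (guide_b th1 th2).
Notation c := (guide_c th1 th2).
Notation k := (guide_k th1 th2).
Notation A1 := (half_guide th1).
Notation A2 := (half_guide th2).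

Let a0 : 0 < a := guide_a_gt0 th1_in th2_in.
Let c0 : 0 < c := guide_c_gt0 th1_in th2_in.
Let k0 : 0 < k := guide_k_gt0 th1_in th2_in.
Let oA2 : open A2 := open_half_guide th2_in.
Let preA : A1 = shear a b c @^-1` A2 := preimage_half_guide th1_in th2_in.
Let contr (s t : R) := guide_map_contracting th1_in th2_in s t th12.

Lemma continuous_line (th alpha : R) : continuous (line th alpha).
Proof.
move=> t; apply: (@cvg_pair _ _ _ (nbhs t) (nbhs _) (nbhs _)) => /=.
  by apply: cvgD; [exact: cvg_cst|apply: cvgMr_tmp; exact: cvg_id].
by apply: cvgMr_tmp; exact: cvg_id.
Qed.

Lemma dir_sqnorm_transport (g : R * R -> R) : continuous g ->
  (dir_sqnorm th1 (g \o T) = k^-1%:E * dir_sqnorm th2 g)%E.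
Proof.
move=> cg; rewrite /dir_sqnorm !line_dir_boundary//; [|by right|by left|by right|by left].
have H (al1 al2 : R) : (forall t, T (line th1 al1 t) = line th2 al2 (k * t)) ->
  (\int[@lebesgue_measure R]_(t in `[0%R, +oo[) ((g \o T) (line th1 al1 t) ^+ 2)%:E =
   k^-1%:E * \int[@lebesgue_measure R]_(t in `[0%R, +oo[) (g (line th2 al2 t) ^+ 2)%:E)%E.
  move=> TE; rewrite integral_mkcond [in RHS]integral_mkcond.
  rewrite -(@ge0_integral_affine R k 0)//.
  - apply: eq_integral => t _; rewrite !patchE addr0 /= TE.
    by congr (if _ then _ else _); apply/idP/idP; rewrite !inE/= !in_itv/= !andbT pmulr_rge0.
  - apply/(measurable_restrictT _ _).1; first exact: measurable_itv.
    apply/measurable_EFinP/measurable_funX; apply: measurable_funTS.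
    apply: continuous_measurable_fun => t.
    by apply: continuous_comp; [exact: continuous_line|exact: cg].
  - by move=> t; rewrite patchE; case: ifP => // _; rewrite lee_fin sqr_ge0.
rewrite (H _ _ (guide_map_line0 th1_in th2_in)) (H _ _ (guide_map_line1 th1_in th2_in)).
by rewrite -ge0_muleDr//; apply: integral_ge0 => t _; rewrite lee_fin sqr_ge0.
Qed.

Lemma H1_sqnorm_ge0 (A : set (R * R)) u : open A -> (0 <= H1_sqnorm A u)%E.
Proof. by move=> oA; rewrite adde_ge0 ?sqnorm_ge0 ?grad_sqnorm_ge0. Qed.

(** If [phi n] approximates [u] with vanishing boundary values, then
    [phi n o T] does the same for [u o T]: H^1 norms and boundary norms are
    multiplied by at most a constant. *)
Lemma is_dir_trace_transport u : in_H1 A2 u -> is_dir_trace th2 u (cst 0) ->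
  is_dir_trace th1 (u \o T) (cst 0).
Proof.
move=> u1 [phi [tphi H1 D0]]; exists (fun n => phi n \o T); split.
- by move=> n; exact: (test_function_comp_shear b a0 c0 (tphi n)).
- apply: (@squeeze_cvge _ _ _ _ (cst 0%E) _
    (fun n => (a * c)^-1%:E * H1_sqnorm A2 (phi n \- u)%R)%E).
  + apply: nearW => n; rewrite preA H1_sqnorm_ge0/=; last exact: open_preimage_shear.
    have := H1_sqnorm_shear_le a0 c0 oA2 contr (u := phi n \- u).
    apply.
    have := in_H1D oA2 (in_H1_test oA2 (tphi n)) (in_H1Z oA2 (-1) u1).
    by congr in_H1; apply/funext => x /=; rewrite mulN1r.
  + exact: cvg_cst.
  + by rewrite -(mule0 (a * c)^-1%:E); apply: cvgeZl.
- rewrite (_ : (fun n => _) = (fun n => k^-1%:E * dir_sqnorm th2 (phi n \- cst 0)%R)%E).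
    by rewrite -(mule0 k^-1%:E); apply: cvgeZl.
  apply/funext => n; rewrite -dir_sqnorm_transport//.
  have [sphi _ _] := tphi n.
  by move=> x; apply: cvgB; [exact: (sphi 0%N)|exact: cvg_cst].
Qed.

Lemma in_H1_dir_transport u : in_H1_dir th2 u -> in_H1_dir th1 (u \o T).
Proof.
move=> [u1 tu]; split; last exact: is_dir_trace_transport.
by rewrite preA; exact: in_H1_shear.
Qed.

Lemma measurable_in_H1 (A : set (R * R)) u : in_H1 A u ->
  measurable_fun (A : set (plane R)) u.
Proof. by case=> -[]. Qed.

Lemma ae_zero_transport u : in_H1 A2 u -> ae_zero A1 (u \o T) <-> ae_zero A2 u.
Proof.
by move=> u1; rewrite preA; apply: ae_zero_shear => //; exact: measurable_in_H1.
Qed.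

(** Numerator and denominator pick up the same Jacobian factor, and the gradient
    is contracted. *)
Lemma rayleigh_transport u : in_H1 A2 u -> ~ ae_zero A2 u ->
  rayleigh A1 (u \o T) <= rayleigh A2 u.
Proof.
move=> u1 nu; have [[mu u2] _ _] := u1.
have mA2 := open_measurable2 oA2.
have uT := in_H1_shear b a0 c0 oA2 u1.
have ge := grad_sqnorm_shear_le a0 c0 oA2 contr u1.
have sE := sqnorm_shear b a0 c0 mA2 mu.
have g1f := grad_sqnorm_fin (@open_preimage_shear _ a b c _ oA2) uT.
have g2f := grad_sqnorm_fin oA2 u1.
have s2f := sqnorm_fin (conj mu u2).
have s2p : 0 < fine (sqnorm A2 u).
  rewrite lt0r fine_ge0 ?sqnorm_ge0// andbT; apply/eqP => e.
  by apply: nu; apply/(sqnorm_eq0 mA2 mu); rewrite -(fineK s2f) e.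
rewrite /rayleigh preA /guide_map sE fineM//=.
rewrite -(fineK g1f) -(fineK g2f) -EFinM lee_fin in ge.
have ac : 0 < (a * c)^-1 by rewrite invr_gt0 mulr_gt0.
exact: ler_scaled_quotient.
Qed.

(** Composition with the map sends a trial family for [th2] to one for [th1]
    and commutes with linear combinations. *)
Lemma lambda_le j : (lambda j th1 <= lambda j th2)%E.
Proof.
apply: le_ereal_inf_tmp => _ [psi [psi1 psi2] <-].
have psiH i : in_H1 A2 (psi i) := (psi1 i).1.
have lcH d := in_H1_lin_comb oA2 d psiH.
apply: (@le_trans _ _ (sup_rayleigh A1 (fun i => psi i \o T))).
  apply: ereal_inf_lbound; exists (fun i => psi i \o T) => //; split.
    by move=> i; exact: in_H1_dir_transport.
  by move=> d /(ae_zero_transport (lcH d)); exact: psi2.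
apply: ge_ereal_sup => _ [_ [[d ->] nz] <-].
have nz2 : ~ ae_zero A2 (lin_comb d psi).
  by move=> z; apply: nz; exact/(ae_zero_transport (lcH d)).
apply: le_trans (_ : ((rayleigh A2 (lin_comb d psi))%:E <= _)%E).
  by rewrite lee_fin; exact: rayleigh_transport.
apply: ereal_sup_ubound; exists (lin_comb d psi) => //; split => //.
by exists d.
Qed.

End Monotonicity.

(** * Nonnegativity and finiteness of the min-max values *)

Section Nonnegativity.
Variables (R : realType).

Lemma rayleigh_ge0 (A : set (R * R)) u : open A -> 0 <= rayleigh A u.
Proof.
by move=> oA; rewrite divr_ge0// fine_ge0// ?sqnorm_ge0 ?grad_sqnorm_ge0.
Qed.

Lemma lambda_ge0 j (theta : R) : (1 <= j)%N -> 0 < theta < pi / 2 ->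
  (0 <= lambda j theta)%E.
Proof.
move=> hj thin; apply: le_ereal_inf_tmp => _ [psi [_ ind] <-].
pose d (i : 'I_j) : R := (i == Ordinal hj)%:R.
have nz : ~ ae_zero (half_guide theta) (lin_comb d psi).
  by move=> /ind/(_ (Ordinal hj))/eqP; rewrite /d eqxx oner_eq0.
apply: le_trans (_ : ((rayleigh (half_guide theta) (lin_comb d psi))%:E <= _)%E).
  by rewrite lee_fin; apply: rayleigh_ge0; exact: open_half_guide.
apply: ereal_sup_ubound; exists (lin_comb d psi) => //; split => //.
by exists d.
Qed.

End Nonnegativity.

Section DisjointFamily.
Variables (R : realType) (A : set (R * R)).
Hypothesis oA : open A.
Let mA : measurable (A : set (plane R)) := open_measurable2 oA.

Lemma sqr_sum_orthogonal n (d : 'I_n -> R) :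
  (forall i k, i != k -> d i * d k = 0) ->
  (\sum_i d i) ^+ 2 = \sum_i d i ^+ 2.
Proof.
move=> H; rewrite expr2 mulr_suml; apply: eq_bigr => i _.
rewrite mulr_sumr (bigD1 i)//= big1 ?addr0 -?expr2// => k ki.
by rewrite H// eq_sym.
Qed.

Variables (j : nat) (psi : 'I_j -> R * R -> R).
Hypothesis tpsi : forall i, test_function A (psi i).
Hypothesis disj : forall i k x, i != k -> support (psi i) x -> ~ support (psi k) x.
Hypothesis nz : forall i, ~ ae_zero A (psi i).

(** At each point at most one term of the combination is nonzero, so the square
    of the sum is the sum of the squares. *)
Lemma sqnorm_lin_comb_disjoint (c : 'I_j -> R) (f : 'I_j -> R * R -> R) :
  (forall i, in_L2 A (f i)) -> (forall i, support (f i) `<=` support (psi i)) ->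
  sqnorm A (lin_comb c f) = (\sum_i c i ^+ 2 * fine (sqnorm A (f i)))%:E.
Proof.
move=> f2 fs; rewrite /sqnorm.
transitivity (\int[@lebesgue2 R]_(x in A) (\sum_(i < j) (c i ^+ 2)%:E * (f i x ^+ 2)%:E))%E.
  apply: eq_integral => x _; rewrite /lin_comb sqr_sum_orthogonal.
    by rewrite -sumEFin; apply: eq_bigr => i _; rewrite exprMn EFinM.
  move=> i k ik; rewrite mulrACA; apply/eqP; rewrite mulf_eq0; apply/orP; right.
  apply: contrapT => /negP; rewrite mulf_eq0 negb_or => /andP[/support_in h /support_in h'].
  exact: (disj ik (fs _ _ h) (fs _ _ h')).
have mf i : measurable_fun (A : set (plane R)) (fun x => (f i x ^+ 2)%:E).
  by apply/measurable_EFinP/measurable_funX; exact: (f2 i).1.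
rewrite ge0_integral_sum//.
- rewrite -sumEFin; apply: eq_bigr => i _.
  rewrite ge0_integralZl//.
  + by rewrite [RHS]EFinM fineK//; exact: sqnorm_fin (f2 i).
  + by move=> x _; rewrite lee_fin sqr_ge0.
  + by rewrite lee_fin sqr_ge0.
- by move=> i; apply: emeasurable_funM => //; exact: measurable_cst.
- by move=> i x _; rewrite -EFinM lee_fin mulr_ge0// sqr_ge0.
Qed.

Lemma is_weak_partial_lin_comb v (c : 'I_j -> R) (f g : 'I_j -> R * R -> R) : axis v ->
  (forall i, in_L2 A (f i)) -> (forall i, is_weak_partial A v (f i) (g i)) ->
  is_weak_partial A v (lin_comb c f) (lin_comb c g).
Proof.
move=> vA f2 fg; rewrite /lin_comb.
have E (h : 'I_j -> R * R -> R) : (fun x => \sum_(i < j) c i * h i x) =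
    \sum_(i < j) (fun x => c i * h i x) by apply/funext => x; rewrite fct_sumE.
rewrite !E.
suff [] : in_L2 A (\sum_(i < j) (fun x => c i * f i x)) /\
  is_weak_partial A v (\sum_(i < j) (fun x => c i * f i x))
    (\sum_(i < j) (fun x => c i * g i x)) by [].
apply: (big_ind2 (fun u w => in_L2 A u /\ is_weak_partial A v u w)).
- by split; [exact: in_L2_cst0|exact: is_weak_partial0].
- move=> u w u' w' [h1 h2] [h3 h4]; split; first exact: in_L2D.
  exact: is_weak_partialD.
- move=> i _; split; first exact: in_L2Z.
  exact: is_weak_partialZ.
Qed.

Let S i := fine (sqnorm A (psi i)).
Let P i := fine (sqnorm A ('D_(e1 R) (psi i))).
Let Q i := fine (sqnorm A ('D_(e2 R) (psi i))).

Let psi2 i : in_L2 A (psi i) := test_function_in_L2 mA (tpsi i).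

Let S_gt0 i : 0 < S i.
Proof.
rewrite lt0r fine_ge0 ?sqnorm_ge0// andbT; apply/eqP => e.
apply: (nz (i := i)); apply/(sqnorm_eq0 mA (psi2 i).1).
by rewrite -(fineK (sqnorm_fin (psi2 i))) -/(S i) e.
Qed.

Lemma lin_indep_disjoint : lin_indep A psi.
Proof.
move=> d /(sqnorm_eq0 mA _).2 H i.
have {}H := H (measurable_in_H1 (in_H1_lin_comb oA d (fun i => in_H1_test oA (tpsi i)))).
rewrite (sqnorm_lin_comb_disjoint d psi2 (fun k => @subset_refl _ _)) in H.
have {}H := EFin_inj H.
have : d i ^+ 2 * S i = 0.
  apply: (psumr_eq0P _ H) => // k _.
  by rewrite mulr_ge0 ?sqr_ge0// ltW// S_gt0.
move/eqP.
by rewrite mulf_eq0 sqrf_eq0 (gt_eqF (S_gt0 i)) orbF => /eqP.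
Qed.

(** Both quadratic forms are diagonal in the family, so the quotient of a
    combination is a weighted mean of the quotients of its members; their sum is
    a bound that needs no maximum. *)
Lemma sup_rayleigh_disjoint_lty : (sup_rayleigh A psi < +oo)%E.
Proof.
pose K := \sum_i (P i + Q i) / S i.
have t_ge0 i : 0 <= (P i + Q i) / S i.
  by rewrite divr_ge0 ?addr_ge0// ?fine_ge0// ?sqnorm_ge0// ltW.
have K0 : 0 <= K by apply: sumr_ge0.
have PQ i : P i + Q i <= K * S i.
  by rewrite -ler_pdivrMr ?S_gt0// /K (bigD1 i)//= lerDl sumr_ge0.
apply: le_lt_trans (ltry K); apply: ge_ereal_sup => _ [_ [[d ->] _] <-].
have w v : axis v -> is_weak_partial A v (lin_comb d psi) (lin_comb d (fun i => 'D_v (psi i))).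
  by move=> vA; apply: is_weak_partial_lin_comb => // i; exact: is_weak_partial_smooth (tpsi i).
have D2 v : axis v -> forall i, in_L2 A ('D_v (psi i)).
  by move=> vA i; exact: test_function_in_L2 mA (test_function_derive vA (tpsi i)).
rewrite lee_fin /rayleigh (grad_sqnormE oA (w _ (axis1 R)) (w _ (axis2 R))).
have E v (vA : axis v) :=
  sqnorm_lin_comb_disjoint d (D2 v vA) (fun i => @support_derive _ (psi i) v).
rewrite [X in (X + _)%E](E _ (axis1 R)) [X in (_ + X)%E](E _ (axis2 R)).
rewrite (sqnorm_lin_comb_disjoint d psi2 (fun k => @subset_refl _ _)).
rewrite -EFinD -big_split/=.
set W := \sum_i _; set Z := \sum_i _.
have Z0 : 0 <= Z by apply: sumr_ge0 => i _; rewrite mulr_ge0 ?sqr_ge0// ltW// S_gt0.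
have [->|Zn0] := eqVneq Z 0; first by rewrite invr0 mulr0.
rewrite ler_pdivrMr ?lt0r ?Zn0// /W /Z mulr_sumr; apply: ler_sum => i _.
by rewrite -mulrDr mulrCA ler_wpM2l ?sqr_ge0// PQ.
Qed.

End DisjointFamily.

Section Finiteness.
Variables (R : realType).

(** The bump is positive on a box of positive measure. *)
Lemma bump_not_ae_zero (A : set (R * R)) n (p q r s : R) : p < q -> r < s ->
  box p q r s `<=` A -> ~ ae_zero A (bump n p q r s).
Proof.
move=> pq rs bA [N [mN N0 sub]].
have bN : box p q r s `<=` N.
  move=> x bx; apply: sub => /(_ (bA _ bx)) /eqP; apply/negP.
  by rewrite bump_neq0 inE.
have : (@lebesgue2 R (box p q r s) <= 0)%E.
  rewrite -N0; apply: le_measure => //; rewrite inE//; exact: measurable_box.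
rewrite /lebesgue2 /= product_measure1E; [|exact: measurable_itv..].
have L (x y : R) : x < y -> lebesgue_measure (`]x, y[%classic : set R) = (y - x)%:E.
  by move=> xy; rewrite lebesgue_measure_itv/= lte_fin xy EFinB.
rewrite (_ : _ * _ = (q - p)%:E * (s - r)%:E)%E; last by congr (_ * _)%E; exact: L.
by rewrite -EFinM lee_fin leNgt mulr_gt0// subr_gt0.
Qed.

Variable theta : R.
Hypothesis thin : 0 < theta < pi / 2.
Let s0 : 0 < sin theta := sin_acute_gt0 thin.
Let c0 : 0 < cos theta := cos_acute_gt0 thin.

(** Points half-way between the two boundary lines, at distances [1], [2], ...
    from the middle of the horizontal edge; their heights differ by at least [sin theta], so squares of
    half-side [sin theta / 4] around them are disjoint, and small enough to stay
    in the half-guide. *)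
Definition mid1 (i : nat) : R := i.+1%:R * cos theta - pi / 2 / sin theta.
Definition mid2 (i : nat) : R := i.+1%:R * sin theta.
Definition radius : R := sin theta / 4.
Definition guide_bump (i : nat) : R * R -> R :=
  bump 0 (mid1 i - radius) (mid1 i + radius) (mid2 i - radius) (mid2 i + radius).

Lemma mid_cbox_half_guide i :
  cbox (mid1 i - radius) (mid1 i + radius) (mid2 i - radius) (mid2 i + radius)
    `<=` half_guide theta.
Proof.
move=> x [/=]; rewrite !in_itv/= => /andP[x1 x1'] /andP[x2 x2'].
have s1 : sin theta <= 1 := sin_le1 theta.
have s_gt0 : 0 < sin theta := s0.
have c1 : cos theta <= 1 := cos_le1 theta.
have pi2 := pi_ge2 R.
have mE : mid1 i * sin theta - mid2 i * cos theta = - (pi / 2).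
  by rewrite /mid1 /mid2; field; rewrite gt_eqF.
have m2 : sin theta <= mid2 i.
  by rewrite /mid2 ler_peMl ?(ltW s0)// ler1n.
have r0 : radius = sin theta / 4 by [].
move: (mid1 i) (mid2 i) radius r0 mE m2 x1 x1' x2 x2' => m1 m2 r r0 mE h x1 x1' x2 x2'.
have small (e t : R) : 0 < t <= 1 -> - r <= e <= r -> - r <= e * t <= r.
  by move=> /andP[t0 t1] /andP[er re]; apply/andP; split; nra.
have /andP[a1 a2] : - r <= (x.1 - m1) * sin theta <= r.
  by apply: small; apply/andP; split => //; lra.
have /andP[b1 b2] : - r <= (x.2 - m2) * cos theta <= r.
  by apply: small; apply/andP; split => //; lra.
by rewrite !mulrBl in a1 a2 b1 b2; apply/(half_guideP thin); split; [lra|lra|lra].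
Qed.

Lemma guide_bump_disjoint (i k : nat) x : i != k ->
  support (guide_bump i) x -> ~ support (guide_bump k) x.
Proof.
wlog ik : i k / (i < k)%N.
  move=> H; case: (ltngtP i k) => // ik _; first by apply: H => //; rewrite ltn_eqF.
  by move=> hi hk; apply: (H k i) hk hi => //; rewrite ltn_eqF.
move=> _ /support_bump [_ /=]; rewrite in_itv/= => /andP[_ h1].
move=> /support_bump [_ /=]; rewrite in_itv/= => /andP[h2 _].
have : mid2 i + sin theta <= mid2 k.
  rewrite /mid2 -{2}[sin theta]mul1r -mulrDl ler_wpM2r ?(ltW s0)//.
  by rewrite natr1 ler_nat ltnS.
by move: h1 h2 s0; rewrite /radius; lra.
Qed.

(** The function is its own approximation, and it vanishes on the boundary since
    its support lies in the open half-guide. *)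
Lemma is_dir_trace_test phi : test_function (half_guide theta) phi ->
  is_dir_trace theta phi (cst 0).
Proof.
move=> tphi; exists (fun _ => phi); split.
- by move=> _; exact: test_function_subset (@subsetT _ _) tphi.
- rewrite (_ : (fun _ => _) = cst 0%E); first exact: cvg_cst.
  apply/funext => n /=; have oA := open_half_guide thin.
  rewrite (_ : phi \- phi = cst 0); last by apply/funext => x /=; rewrite subrr.
  have z : sqnorm (half_guide theta) (cst 0 : R * R -> R) = 0%E.
    by rewrite /sqnorm integral0_eq// => x _; rewrite expr0n.
  rewrite /H1_sqnorm (grad_sqnormE oA (is_weak_partial0 _ _) (is_weak_partial0 _ _)).
  by rewrite z !adde0.
- rewrite (_ : (fun _ => _) = cst 0%E); first exact: cvg_cst.
  apply/funext => n /=; rewrite /dir_sqnorm.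
  rewrite !integral0_eq ?adde0// => t /= /(dir_boundary_out thin) nh;
  have [_ _ sA] := tphi;
  by rewrite (support_out (f := phi)) ?subrr ?expr0n// => /sA.
Qed.

Lemma lambda_lty j : (lambda j theta < +oo)%E.
Proof.
have oA := open_half_guide thin.
pose psi (i : 'I_j) := guide_bump i.
have tpsi i : test_function (half_guide theta) (psi i).
  by apply: test_function_bump; exact: mid_cbox_half_guide.
have dis (i k : 'I_j) x : i != k -> support (psi i) x -> ~ support (psi k) x.
  by move=> ik; exact: guide_bump_disjoint.
have r0 : 0 < radius by rewrite /radius divr_gt0.
have nz (i : 'I_j) : ~ ae_zero (half_guide theta) (psi i).
  apply: bump_not_ae_zero; [lra|lra|].
  by apply: subset_trans (@mid_cbox_half_guide i); exact: box_subset_cbox.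
apply: le_lt_trans (sup_rayleigh_disjoint_lty oA tpsi dis nz).
apply: ereal_inf_lbound; exists psi => //; split.
  by move=> i; split; [exact: in_H1_test (tpsi i)|exact: is_dir_trace_test].
exact: lin_indep_disjoint.
Qed.

End Finiteness.

Theorem proposition3p1 (R : realType) (j : nat) (hj : (1 <= j)%N) :
  (forall theta : R, 0 < theta < pi / 2 ->
     (0 <= lambda j theta < +oo)%E) /\
  (forall theta1 theta2 : R, 0 < theta1 < pi / 2 -> 0 < theta2 < pi / 2 ->
     theta1 <= theta2 -> (lambda j theta1 <= lambda j theta2)%E).
Proof.
split=> [theta thin|th1 th2 th1_in th2_in le12]; last exact: lambda_le.
by rewrite lambda_ge0// lambda_lty.
Qed.
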